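(* Let $\mathsf{MG}$ be the category whose objects are MAT-labeled graphs and whose morphisms are label-preserving homomorphisms, and let $\mathsf{LRV}$ be the category whose objects are LR-vines and whose morphisms are poset homomorphisms preserving rank and join. Let $\Psi\colon \mathsf{MG}\to\mathsf{LRV}$ be the functor sending an MAT-labeled graph $(G,\lambda)$ to the poset $\Psi(G,\lambda)$ (described in the context) and a morphism $\sigma\colon (G,\lambda)\to(G',\lambda')$ to the map $\Psi(\sigma)\colon v\mapsto \{\sigma(a)\mid a\in v\}$; let $\Omega\colon\mathsf{LRV}\to\mathsf{MG}$ be the functor sending an LR-vine $\mathcal{P}$ to the edge-labeled graph $\Omega(\mathcal{P})$ (described in the context) and a morphism $\varphi\colon\mathcal{P}\to\mathcal{P}'$ to the map $\Omega(\varphi)\colon i\mapsto\varphi(i)$ on minimal elements. Then the composite functor $\Psi\Omega$ is naturally isomorphic to the identity functor $1_{\mathsf{LRV}}$, and $\Omega\Psi$ is naturally isomorphic to the identity functor $1_{\mathsf{MG}}$. In particular, the categories $\mathsf{MG}$ and $\mathsf{LRV}$ are equivalent.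
   Context: Graphs are finite, simple and undirected. An edge-labeled graph $(G,\lambda)$ is a graph $G$ with a map $\lambda\colon E_G\to\mathbb{Z}_{>0}$; write $\lambda(u,v)=\lambda(\{u,v\})$, $\pi_k=\lambda^{-1}(k)$, $\pi_{<k}=\bigcup_{j<k}\pi_j$, $\pi_{\le k}=\bigcup_{j\le k}\pi_j$. For an edge $\{u,v\}\in\pi_k$, a conditioning vertex is a vertex $h$ with $\{u,h\},\{v,h\}\in E_G$ both of label $<k$. $\lambda$ is an MAT-labeling (and $(G,\lambda)$ an MAT-labeled graph) if for every $k\in\mathbb{Z}_{>0}$: (ML1) no edge $e\in\pi_{\le k}$ forms a cycle with edges in $\pi_k$; (ML2) every edge in $\pi_k$ has exactly $k-1$ conditioning vertices. For an edge $e=\{i,j\}\in\pi_k$ with conditioning vertices $h_1,\dots,h_{k-1}$, the principal clique generated by $e$ is $K_e=\{i,j,h_1,\dots,h_{k-1}\}$. A label-preserving homomorphism $\sigma\colon(G,\lambda)\to(G',\lambda')$ is a map $\sigma\colon N_G\to N_{G'}$ such that every edge $\{u,v\}\in E_G$ satisfies $\{\sigma(u),\sigma(v)\}\in E_{G'}$ and $\lambda'(\sigma(u),\sigma(v))=\lambda(u,v)$. Posets are finite. A poset $\mathcal{P}$ is graded with rank function $\operatorname{rk}\colon\mathcal{P}\to\mathbb{Z}_{>0}$ if $x<y$ implies $\operatorname{rk}(x)<\operatorname{rk}(y)$, $\operatorname{rk}(y)=\operatorname{rk}(x)+1$ whenever $y$ covers $x$, and all minimal elements have rank $1$. Let $\mathcal{P}_i$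 be the set of elements of rank $i$, $\operatorname{rk}(\mathcal{P})$ the maximal rank, $\dim(\mathcal{P})$ the number of minimal elements, and $\mathcal{E}(v)$ the set of elements covered by $v$. A vine is a finite graded poset such that (1) every non-minimal element covers exactly two elements, and any two distinct elements of the same rank are covered by at most one common element; (2) for each $1\le i\le\operatorname{rk}(\mathcal{P})$ the graph $F_i$ with vertex set $\mathcal{P}_i$ and edge set $\{\mathcal{E}(v)\mid v\in\mathcal{P}_{i+1}\}$ is a forest. A vine is an R-vine if $\operatorname{rk}(\mathcal{P})=\dim(\mathcal{P})$, each $F_i$ is a tree, and (proximity) any two distinct elements of the same rank $i\ge2$ that are covered by a common element cover a common element. A vine is an LR-vine if every principal ideal $\mathcal{P}_{\le v}=\{x\mid x\le v\}$ (with induced order and rank) is an R-vine. A homomorphism $\varphi$ of graded posets preserves rank if $\operatorname{rk}'(\varphi(x))=\operatorname{rk}(x)$, and preserves join if whenever the join $x\vee y$ exists, $\varphi(x)\vee\varphi(y)$ exists and equals $\varphi(x\vee y)$. $\Psi(G,\lambda)$: the poset whose elements are the singletons $\{i\}$, $i\in N_G$, and all principal cliques $K_e$, $e\in E_G$, ordered by inclusion, with rank equal to cardinality. $\Omega(\mathcal{P})$: the edge-labeled graph with vertex set the minimal elements of $\mathcal{P}$, with $\{i,j\}$ ($i\neq j$) an edge iff the join $i\vee j$ exists in $\mathcal{P}$, labeled $\lambda(i,j)=\operatorname{rk}(i\vee j)-1$. *)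

(* Defs.v *)
From HB Require Import structures.
From mathcomp Require Import all_boot all_order.

Set Implicit Arguments.
Unset Strict Implicit.
Unset Printing Implicit Defensive.

Import Order.TTheory Order.DefaultSetSubsetOrder.
Local Open Scope order_scope.

Record category := Category {
  Ob :> Type;
  Hom : Ob -> Ob -> Type;
  idm : forall a, Hom a a;
  compm : forall x y z, Hom y z -> Hom x y -> Hom x z;
  comp1m : forall a b (f : Hom a b), compm (idm b) f = f;
  compm1 : forall a b (f : Hom a b), compm f (idm a) = f;
  compmA : forall a b c d (h : Hom c d) (g : Hom b c) (f : Hom a b),
    compm h (compm g f) = compm (compm h g) f }.

Arguments Hom {_} _ _.
Arguments idm {_} _.
Arguments compm {_} [x y z] _ _.

(* A functor is indexed by its action on objects, so that this action can be
   prescribed definitionally. *)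
Record functor (C D : category) (F0 : C -> D) := Functor {
  fmap : forall a b : C, Hom a b -> Hom (F0 a) (F0 b);
  fmap_id : forall a, fmap (idm a) = idm (F0 a);
  fmap_comp : forall a b c (g : Hom b c) (f : Hom a b),
    fmap (compm g f) = compm (fmap g) (fmap f) }.

Arguments fmap {C D F0} _ [a b] _.

Definition functor_id (C : category) : functor (fun a : C => a) :=
  @Functor C C (fun a => a) (fun a b f => f)
    (fun _ => erefl) (fun _ _ _ _ _ => erefl).

Section FunctorComp.
Variables (C D E : category) (F0 : C -> D) (G0 : D -> E).
Variables (G : functor G0) (F : functor F0).

Fact functor_comp_id a : fmap G (fmap F (idm a)) = idm (G0 (F0 a)).
Proof. by rewrite !fmap_id. Qed.

Fact functor_comp_comp a b c (g : Hom b c) (f : Hom a b) :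
  fmap G (fmap F (compm g f)) = compm (fmap G (fmap F g)) (fmap G (fmap F f)).
Proof. by rewrite !fmap_comp. Qed.

Definition functor_comp : functor (fun a : C => G0 (F0 a)) :=
  @Functor C E (fun a => G0 (F0 a)) (fun a b f => fmap G (fmap F f))
    functor_comp_id functor_comp_comp.

End FunctorComp.

Definition naturally_isomorphic (C D : category) (F0 G0 : C -> D)
    (F : functor F0) (G : functor G0) : Prop :=
  exists (eta : forall a, Hom (F0 a) (G0 a)) (eta' : forall a, Hom (G0 a) (F0 a)),
  [/\ forall a b (f : Hom a b),
        compm (eta b) (fmap F f) = compm (fmap G f) (eta a),
      forall a, compm (eta' a) (eta a) = idm (F0 a)
    & forall a, compm (eta a) (eta' a) = idm (G0 a)].

Definition equivalent_categories (C D : category) : Prop :=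
  exists (F0 : C -> D) (F : functor F0) (G0 : D -> C) (G : functor G0),
    naturally_isomorphic (functor_comp G F) (functor_id C) /\
    naturally_isomorphic (functor_comp F G) (functor_id D).

(* The labeling of the edges is extended by 0 to the pairs that are not edges. *)
Record labeled_graph := LabeledGraph {
  vertex :> finType;
  adj : rel vertex;
  label : vertex -> vertex -> nat;
  adj_irr : irreflexive adj;
  adj_sym : symmetric adj;
  label_sym : forall u v, label u v = label v u;
  label_gt0 : forall u v, (0 < label u v)%N = adj u v }.

Arguments adj {l} _ _.
Arguments label {l} _ _.

Section MATLabeling.
Variable G : labeled_graph.
Implicit Types (u v h : G) (k : nat).

Definition label_class k : rel G := [rel u v | adj u v && (label u v == k)].

(* The vertices u, v, p_1, ..., p_m (m >= 1) are those of a cycle through the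
   edge {u, v} all of whose other edges have label k. *)
Definition forms_cycle k u v : Prop :=
  exists p : seq G,
    [/\ p != [::], uniq [:: u, v & p], path (label_class k) v p
      & label_class k (last v p) u].

Definition cond_vertices u v : {set G} :=
  [set h | [&& adj u h, adj v h, (label u h < label u v)%N
             & (label v h < label u v)%N]].

Definition MAT_labeling : Prop :=
  forall k, (0 < k)%N ->
    (forall u v, adj u v -> (label u v <= k)%N -> ~ forms_cycle k u v) /\
    (forall u v, label_class k u v -> #|cond_vertices u v| = k.-1).

Definition principal_clique u v : {set G} := [set u; v] :|: cond_vertices u v.

End MATLabeling.

Record MAT_graph := MATGraph {
  MAT_graph_graph :> labeled_graph;
  MAT_graph_labeling : MAT_labeling MAT_graph_graph }.

Definition label_preserving (G G' : labeled_graph) (s : {ffun G -> G'}) : bool :=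
  [forall u, forall v,
     adj u v ==> adj (s u) (s v) && (label (s u) (s v) == label u v)].

Definition MG_hom (G G' : labeled_graph) :=
  {s : {ffun G -> G'} | label_preserving s}.

Definition MG_fun (G G' : labeled_graph) (s : MG_hom G G') : {ffun G -> G'} :=
  sval s.

Fact MG_id_subproof (G : labeled_graph) :
  label_preserving [ffun u : G => u].
Proof.
by apply/forallP=> u; apply/forallP=> v; apply/implyP; rewrite !ffunE eqxx andbT.
Qed.

Definition MG_id (G : labeled_graph) : MG_hom G G := Sub _ (MG_id_subproof G).

Fact MG_comp_subproof (G G' G'' : labeled_graph)
    (t : MG_hom G' G'') (s : MG_hom G G') :
  label_preserving [ffun u => val t (val s u)].
Proof.
apply/forallP=> u; apply/forallP=> v; apply/implyP=> uv; rewrite !ffunE.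
have /andP[uv' /eqP<-] := implyP (forallP (forallP (valP s) u) v) uv.
exact: implyP (forallP (forallP (valP t) _) _) uv'.
Qed.

Definition MG_comp (G G' G'' : labeled_graph)
    (t : MG_hom G' G'') (s : MG_hom G G') : MG_hom G G'' :=
  Sub _ (MG_comp_subproof t s).

Fact MG_comp1m (G G' : MAT_graph) (s : MG_hom G G') : MG_comp (MG_id G') s = s.
Proof. by apply/val_inj/ffunP => u; rewrite /= !ffunE /= ?ffunE. Qed.

Fact MG_compm1 (G G' : MAT_graph) (s : MG_hom G G') : MG_comp s (MG_id G) = s.
Proof. by apply/val_inj/ffunP => u; rewrite /= !ffunE /= ?ffunE. Qed.

Fact MG_compmA (G1 G2 G3 G4 : MAT_graph)
    (r : MG_hom G3 G4) (t : MG_hom G2 G3) (s : MG_hom G1 G2) :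
  MG_comp r (MG_comp t s) = MG_comp (MG_comp r t) s.
Proof. by apply/val_inj/ffunP => u; rewrite /= !ffunE /= ?ffunE. Qed.

Definition MG : category :=
  @Category MAT_graph (fun G G' => MG_hom G G') (fun G => MG_id G)
    (fun _ _ _ => @MG_comp _ _ _) MG_comp1m MG_compm1 MG_compmA.

Record ranked_poset := RankedPoset {
  rp_disp : Order.disp_t;
  rp_sort :> finPOrderType rp_disp;
  rk : rp_sort -> nat }.

Arguments rk {r} _.

Section RankedPoset.
Variable P : ranked_poset.
Implicit Types (x y z v : P) (i : nat).

Definition minimal x : bool := [forall y, ~~ (y < x)].

Definition covers y x : bool := (x < y) && ~~ [exists z, x < z < y].

Definition is_join x y z : bool :=
  [&& x <= z, y <= z & [forall w, (x <= w) && (y <= w) ==> (z <= w)]].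

Definition graded : Prop :=
  [/\ forall x, (0 < rk x)%N,
      forall x y, x < y -> (rk x < rk y)%N,
      forall x y, covers y x -> rk y = (rk x).+1
    & forall x, minimal x -> rk x = 1%N].

Definition poset_rank : nat := \max_(x : P) rk x.

Definition poset_dim : nat := #|[set x : P | minimal x]|.

Definition covered v : {set P} := [set x | covers v x].

Definition level i : {set P} := [set x | rk x == i].

Definition level_edges i : {set {set P}} := [set covered v | v in level i.+1].

Definition level_adj i : rel P :=
  [rel x y | [&& x \in level i, y \in level i, x != y
               & [set x; y] \in level_edges i]].

Definition level_forest i : Prop :=
  forall c : seq P, (2 < size c)%N -> ~ ucycle (level_adj i) c.

Definition level_tree i : Prop :=
  [/\ level i != set0, level_forest i
    & {in level i &, forall x y, connect (level_adj i) x y}].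

Definition vine : Prop :=
  [/\ graded,
      forall v, ~~ minimal v -> #|covered v| = 2,
      forall x y v w, x != y -> rk x = rk y ->
        covers v x -> covers v y -> covers w x -> covers w y -> v = w
    & forall i, (1 <= i <= poset_rank)%N -> level_forest i].

Definition proximity : Prop :=
  forall x y, x != y -> rk x = rk y -> (2 <= rk x)%N ->
    (exists v, covers v x /\ covers v y) ->
    exists w, covers x w /\ covers y w.

Definition R_vine : Prop :=
  [/\ vine, poset_rank = poset_dim,
      forall i, (1 <= i <= poset_rank)%N -> level_tree i
    & proximity].

End RankedPoset.

Section PrincipalIdeal.
Variables (P : ranked_poset) (v : P).

Definition ideal_sort := {x : P | x <= v}.

HB.instance Definition _ := SubType.on ideal_sort.
HB.instance Definition _ := Finite.on ideal_sort.
HB.instance Definition _ :=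
  [SubChoice_isSubPOrder of ideal_sort by <: with rp_disp P].

Definition principal_ideal : ranked_poset :=
  @RankedPoset (rp_disp P) ideal_sort (fun x => rk (val x)).

End PrincipalIdeal.

Definition LR_vine (P : ranked_poset) : Prop :=
  vine P /\ forall v : P, R_vine (principal_ideal v).

Record LR_vine_poset := LRVinePoset {
  LR_vine_poset_poset :> ranked_poset;
  LR_vine_posetP : LR_vine LR_vine_poset_poset }.

Definition rank_join_preserving (P P' : ranked_poset) (f : {ffun P -> P'}) : bool :=
  [&& [forall x, forall y, (x <= y) ==> (f x <= f y)],
      [forall x, rk (f x) == rk x]
    & [forall x, forall y, forall z, is_join x y z ==> is_join (f x) (f y) (f z)]].

Definition LRV_hom (P P' : ranked_poset) :=
  {f : {ffun P -> P'} | rank_join_preserving f}.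

Definition LRV_fun (P P' : ranked_poset) (f : LRV_hom P P') : {ffun P -> P'} :=
  sval f.

Fact LRV_id_subproof (P : ranked_poset) :
  rank_join_preserving [ffun x : P => x].
Proof.
apply/and3P; split; apply/forallP=> x; rewrite ?ffunE //;
  do ?[apply/forallP=> ?]; apply/implyP; by rewrite !ffunE.
Qed.

Definition LRV_id (P : ranked_poset) : LRV_hom P P := Sub _ (LRV_id_subproof P).

Fact LRV_comp_subproof (P P' P'' : ranked_poset)
    (g : LRV_hom P' P'') (f : LRV_hom P P') :
  rank_join_preserving [ffun x => val g (val f x)].
Proof.
have /and3P[f1 /forallP f2 f3] := valP f.
have /and3P[g1 /forallP g2 g3] := valP g.
apply/and3P; split; apply/forallP=> x.
- apply/forallP=> y; apply/implyP=> xy; rewrite !ffunE.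
  have xy' := implyP (forallP (forallP f1 x) y) xy.
  exact: implyP (forallP (forallP g1 _) _) xy'.
- by rewrite ffunE (eqP (g2 _)).
- apply/forallP=> y; apply/forallP=> z; apply/implyP=> xyz; rewrite !ffunE.
  have xyz' := implyP (forallP (forallP (forallP f3 x) y) z) xyz.
  exact: implyP (forallP (forallP (forallP g3 _) _) _) xyz'.
Qed.

Definition LRV_comp (P P' P'' : ranked_poset)
    (g : LRV_hom P' P'') (f : LRV_hom P P') : LRV_hom P P'' :=
  Sub _ (LRV_comp_subproof g f).

Fact LRV_comp1m (P P' : LR_vine_poset) (f : LRV_hom P P') :
  LRV_comp (LRV_id P') f = f.
Proof. by apply/val_inj/ffunP => x; rewrite /= !ffunE /= ?ffunE. Qed.

Fact LRV_compm1 (P P' : LR_vine_poset) (f : LRV_hom P P') :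
  LRV_comp f (LRV_id P) = f.
Proof. by apply/val_inj/ffunP => x; rewrite /= !ffunE /= ?ffunE. Qed.

Fact LRV_compmA (P1 P2 P3 P4 : LR_vine_poset)
    (h : LRV_hom P3 P4) (g : LRV_hom P2 P3) (f : LRV_hom P1 P2) :
  LRV_comp h (LRV_comp g f) = LRV_comp (LRV_comp h g) f.
Proof. by apply/val_inj/ffunP => x; rewrite /= !ffunE /= ?ffunE. Qed.

Definition LRV : category :=
  @Category LR_vine_poset (fun P P' => LRV_hom P P') (fun P => LRV_id P)
    (fun _ _ _ => @LRV_comp _ _ _) LRV_comp1m LRV_compm1 LRV_compmA.

Section Psi.
Variable G : labeled_graph.

Definition psi_elt (A : {set G}) : bool :=
  [exists i : G, A == [set i]] ||
  [exists i : G, exists j : G, adj i j && (A == principal_clique i j)].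

(* The order induced from the default order on [{set G}] is inclusion. *)
Definition psi_sort := {A : {set G} | psi_elt A}.

HB.instance Definition _ := SubType.on psi_sort.
HB.instance Definition _ := Finite.on psi_sort.
HB.instance Definition _ :=
  [SubChoice_isSubPOrder of psi_sort by <: with Order.SetSubsetOrder.subset_display].

Definition psi : ranked_poset :=
  @RankedPoset _ psi_sort (fun A => #|(val A : {set G})|).

Definition psi_set (A : psi) : {set G} := sval A.

End Psi.

Section Omega.
Variable P : LR_vine_poset.

Definition omega_sort := {x : P | minimal x}.

Definition omega_adj : rel omega_sort :=
  [rel i j | (i != j) && [exists z, is_join (val i) (val j) z]].

(* The join is unique when it exists, so [pick] returns it. *)
Definition omega_label (i j : omega_sort) : nat :=
  if [pick z | is_join (val i) (val j) z] is Some z then (rk z).-1 else 0%N.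

Fact omega_adj_irr : irreflexive omega_adj.
Proof. by move=> i; rewrite /omega_adj /= eqxx. Qed.

Fact is_joinC (x y z : P) : is_join x y z = is_join y x z.
Proof.
rewrite /is_join andbCA; congr [&& _, _ & _].
by apply: eq_forallb => w; rewrite [X in X ==> _]andbC.
Qed.

Fact omega_adj_sym : symmetric omega_adj.
Proof.
move=> i j; rewrite /omega_adj /= eq_sym; congr (_ && _).
by apply: eq_existsb => z; rewrite is_joinC.
Qed.

Fact omega_label_sym i j : omega_label i j = omega_label j i.
Proof.
by rewrite /omega_label (eq_pick (is_joinC (val i) (val j))).
Qed.

Fact omega_label_gt0 i j : (0 < omega_label i j)%N = omega_adj i j.
Proof.
have [[_ ltP _ minP] _ _ _] := (LR_vine_posetP P).1.
rewrite /omega_label /omega_adj /=; case: pickP => [z zP|noz]; last first.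
  by rewrite ltnn; case: existsP => [[z]|_]; rewrite ?noz ?andbF.
have -> : [exists z, is_join (val i) (val j) z] by apply/existsP; exists z.
rewrite andbT; have /and3P[iz jz /forallP zmin] := zP.
have rki := minP _ (valP i); have [eij|neij] /= := eqVneq i j.
  have zi : z = val i.
    by apply/le_anti; rewrite iz andbT (implyP (zmin _)) // -eij lexx.
  by rewrite zi rki.
have iz' : val i < z.
  rewrite lt_neqAle iz andbT; apply: contra_neq neij => ziE.
  apply/val_inj; move: jz; rewrite -ziE le_eqVlt => /orP[/eqP/esym//|ji].
  by move/forallP: (valP i) => /(_ (val j)) /negP[].
by have := ltP _ _ iz'; rewrite rki; case: (rk z) => [|[]].
Qed.

Definition omega : labeled_graph :=
  @LabeledGraph omega_sort omega_adj omega_label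
    omega_adj_irr omega_adj_sym omega_label_sym omega_label_gt0.

Definition omega_elt (i : omega) : P := sval i.

End Omega.

(* Main.v *)
(* Two elements of rank m of a vine are siblings when some element of rank m+1
   covers both; on each level this relation is a forest, and [branch h i] is
   the edge at [h] on the way to [i]. In an LR-vine the way between two elements
   lies in every ideal containing both, so a statement about x and y of rank m
   with a common upper bound can be replaced by one about [branch x y] and
   [branch y x], of rank m+1. This descent yields the existence of joins, the
   fact that one of the three joins of a triple contains the whole triple (hence
   ML2 for Omega), and a bound on chains of joins (hence ML1).

   Conversely, let e = ij be an edge of label k of an MAT-labeled graph. The same
   descent, in the poset of the edges of label < k, shows that i and j can only
   have k-1 common neighbours if these neighbours together with i, and together
   with j, form principal cliques. So K_e is a clique and K_e \ i, K_e \ j are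
   principal. The forests come by induction on the level: a cycle of siblings
   of rank m+1 all cover one element M of rank m, because otherwise it would
   cross an edge of the forest below exactly once; the vertices outside M
   then form a cycle of edges of equal label, against ML1. *)

Require Import Defs.
From mathcomp Require Import all_boot all_order.

Set Implicit Arguments.
Unset Strict Implicit.
Unset Printing Implicit Defensive.

Import Order.TTheory Order.DefaultSetSubsetOrder.

(* What is available before the levels are known to be forests. *)
Definition previne (P : ranked_poset) : Prop :=
  [/\ graded P,
      forall v : P, ~~ minimal v -> #|covered v| = 2
    & forall x y v w : P, x != y -> rk x = rk y ->
        covers v x -> covers v y -> covers w x -> covers w y -> v = w].

Lemma vine_previne P : vine P -> previne P.
Proof. by case=> g c u _; split. Qed.

Coercion vine_previne : vine >-> previne.

(** * Ranks, covers and siblings *)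

Section PrevineTheory.
Local Open Scope order_scope.
Variables (P : ranked_poset).
Implicit Types (u v w x y z h i j g : P).

Definition sibling : rel P :=
  [rel x y | (x != y) && [exists v, covers v x && covers v y]].

(** The edges of the forests of the principal ideal of [w], expressed in [P] itself. *)
Definition sibling_in w : rel P :=
  [rel x y | (x != y) && [exists v, [&& v <= w, covers v x & covers v y]]].

Definition sibling_off h : rel P :=
  [rel x y | [&& sibling x y, x != h & y != h]].

(** All that the descent uses of the R-vine conditions on ideals. It is isolated because in any vine
    it follows from proximity, which is how it is obtained for [psi]. *)
Definition ideals_connected : Prop :=
  forall w x y, x <= w -> y <= w -> rk x = rk y -> connect (sibling_in w) x y.

(* In the forest on the level of [h], the edge at [h] on the way to [i]. *)
Definition branch h i : P :=
  odflt h [pick g | covers g h &&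
    [exists h', [&& h' != h, covers g h' & connect (sibling_off h) h' i]]].

Lemma sibling_sym : symmetric sibling.
Proof.
move=> x y; rewrite /sibling /= eq_sym; congr (_ && _).
by apply: eq_existsb => v; rewrite andbC.
Qed.

Lemma connect_sibling_sym : connect_sym sibling.
Proof. exact/sym_connect_sym/sibling_sym. Qed.

Lemma connect_sibling_off_sym h : connect_sym (sibling_off h).
Proof.
apply: sym_connect_sym => x y; rewrite /sibling_off /= sibling_sym.
by rewrite [X in _ && X]andbC.
Qed.

Lemma sibling_in_sub w : subrel (sibling_in w) sibling.
Proof.
move=> x y /andP[xy /existsP[v /and3P[_ vx vy]]].
by rewrite /sibling /= xy; apply/existsP; exists v; rewrite vx.
Qed.

Lemma sibling_off_sub h : subrel (sibling_off h) sibling.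
Proof. by move=> x y /and3P[]. Qed.

Lemma covers_lt v x : covers v x -> x < v.
Proof. by case/andP. Qed.

Lemma covers_le v x : covers v x -> x <= v.
Proof. by move/covers_lt/ltW. Qed.

Hypothesis preP : previne P.

Lemma rk_gt0 x : (0 < rk x)%N.
Proof. by case: preP => [[H]]. Qed.

Lemma rk_lt x y : x < y -> (rk x < rk y)%N.
Proof. by case: preP => [[_ H _ _] _ _]; apply: H. Qed.

Lemma rk_le x y : x <= y -> (rk x <= rk y)%N.
Proof. by rewrite le_eqVlt => /predU1P[->//|/rk_lt/ltnW]. Qed.

Lemma rk_covers v x : covers v x -> rk v = (rk x).+1.
Proof. by case: preP => [[_ _ H _] _ _]; apply: H. Qed.

Lemma le_rk_eq x y : x <= y -> (rk y <= rk x)%N -> x = y.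
Proof.
by rewrite le_eqVlt => /predU1P[//|/rk_lt]; rewrite ltnNge => /negP.
Qed.

Lemma minimalE x : minimal x = (rk x == 1)%N.
Proof.
apply/idP/eqP => [|x1]; first by case: preP => [[_ _ _ H] _ _]; apply: H.
apply/forallP => y; apply/negP => /rk_lt.
by rewrite x1 ltnS leqNgt rk_gt0.
Qed.

Lemma lt_covers x v : x < v -> (rk v <= (rk x).+1)%N -> covers v x.
Proof.
move=> xv rkv; rewrite /covers xv; apply/existsP=> -[z /andP[/rk_lt xz /rk_lt zv]].
by have := leq_ltn_trans xz zv; rewrite ltnNge rkv.
Qed.

Lemma ex_covers x v : x < v -> exists2 a, covers v a & x <= a.
Proof.
move=> xv; have Px : (x <= x) && (x < v) by rewrite lexx.
case: (@arg_maxnP _ x (fun a => (x <= a) && (a < v)) (@rk P) Px).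
move=> a /andP[xa av] amax; exists a => //; rewrite /covers av.
apply/existsP=> -[z /andP[az zv]].
have := amax z; rewrite zv (ltW (le_lt_trans xa az)) => /(_ isT).
by move=> /(leq_trans (rk_lt az)); rewrite ltnn.
Qed.

Lemma covers_uniq x y v w :
  x != y -> covers v x -> covers v y -> covers w x -> covers w y -> v = w.
Proof.
case: preP => [_ _ H] xy vx vy; apply: H (vx) (vy) => //.
by have := rk_covers vx; rewrite (rk_covers vy) => -[].
Qed.

Lemma covered_pair v x y z :
  x != y -> covers v x -> covers v y -> covers v z -> z = x \/ z = y.
Proof.
move=> xy vx vy vz; have [_ H _] := preP.
have /H/eqP/cards2P[a [b [ab vab]]] : ~~ minimal v.
  by apply/forallPn; exists x; rewrite negbK covers_lt.
have in2 t : covers v t -> t = a \/ t = b.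
  move=> vt; have : t \in covered v by rewrite inE.
  by rewrite vab !inE => /orP[] /eqP; [left|right].
move: xy; case: (in2 _ vx) => ->; case: (in2 _ vy) => ->; case: (in2 _ vz) => ->;
  by rewrite ?eqxx //; auto.
Qed.

Lemma ex_covered v : (1 < rk v)%N ->
  exists a b, [/\ a != b, covers v a, covers v b &
                forall z, covers v z -> z = a \/ z = b].
Proof.
move=> v1; have [_ H _] := preP.
have /H/eqP/cards2P[a [b [ab vab]]] : ~~ minimal v.
  by rewrite minimalE neq_ltn v1 orbT.
exists a, b; have in2 t : covers v t = (t \in [set a; b]) by rewrite -vab inE.
by split=> //; rewrite ?in2 ?set21 ?set22// => z; rewrite in2 !inE => /orP[] /eqP; auto.
Qed.

Lemma sibling_rk x y : sibling x y -> rk x = rk y.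
Proof.
case/andP=> _ /existsP[v /andP[/rk_covers vx /rk_covers vy]].
by move: vx; rewrite vy => -[].
Qed.

Lemma connect_sibling_rk x y : connect sibling x y -> rk x = rk y.
Proof.
case/connectP=> p; elim: p x => [|a p IH] x /=; first by move=> _ ->.
by case/andP=> /sibling_rk -> pa /(IH _ pa).
Qed.

Lemma rk_le_poset_rank x : (rk x <= poset_rank P)%N.
Proof. exact: (@leq_bigmax _ (@rk P)). Qed.

Lemma level_adjP k x y : level_adj k x y = (rk x == k) && sibling x y.
Proof.
rewrite /level_adj /= /level /level_edges !inE.
apply/and4P/andP => [[rx ry xy /imsetP[v _ xyE]]|[rx sxy]].
  split=> //; rewrite /sibling /= xy; apply/existsP; exists v.
  have : (x \in covered v) && (y \in covered v) by rewrite -xyE set21 set22.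
  by rewrite !inE.
rewrite -(sibling_rk sxy) rx; case/andP: sxy => xy /existsP[v /andP[vx vy]].
rewrite xy; split=> //; apply/imsetP; exists v.
  by rewrite inE (rk_covers vx) (eqP rx).
apply/setP=> z; rewrite !inE; apply/orP/idP => [[/eqP->//|/eqP->//]|vz].
by case: (covered_pair xy vx vy vz) => ->; rewrite eqxx; auto.
Qed.

Lemma path_level_adj x p : path sibling x p -> path (level_adj (rk x)) x p.
Proof.
elim: p x => //= y p IH x /andP[xy /IH]; rewrite -(sibling_rk xy) => ->.
by rewrite level_adjP eqxx xy.
Qed.

End PrevineTheory.

Arguments sibling {P}.

(** * Descent along the levels of a vine *)

Section VineTheory.
Local Open Scope order_scope.
Variable P : ranked_poset.
Implicit Types (u v w x y z h i j g : P).
Hypothesis vineP : vine P.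

Lemma sibling_acyclic (c : seq P) : (2 < size c)%N -> ~ ucycle sibling c.
Proof.
case: c => // x s sz /andP[/(path_level_adj vineP) cx ux]; have [_ _ _ H] := vineP.
apply: (H (rk x) _ _ sz); first by rewrite (rk_gt0 vineP) rk_le_poset_rank.
by apply/andP.
Qed.

(** A way from [a] to [b] that avoids [x] would close up through [x] to a cycle. This makes [branch]
    well defined. *)
Lemma sibling_off_uniq x a b :
  sibling x a -> sibling x b -> connect (sibling_off x) a b -> a = b.
Proof.
move=> xa xb /connectP[p0 p0P]; case/shortenP: p0P => p pp up _ bE {p0}.
have sp : path sibling a p by apply: sub_path pp; apply: sibling_off_sub.
have xp : x \notin a :: p.
  have ax : x != a by case/andP: xa.
  rewrite inE negb_or ax /=.
  elim: p a {xa ax up bE sp} pp => //= c p IH a /andP[/and3P[_ _ cx] /IH cp].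
  by rewrite inE negb_or eq_sym cx.
case: p => [|c p] in bE pp up sp xp *; first by rewrite bE.
case: (@sibling_acyclic [:: x, a, c & p]) => //; apply/andP; split.
  rewrite -[cycle _ _]/(path sibling x (rcons (a :: c :: p) x)) rcons_path.
  rewrite -[path _ x _]/(sibling x a && path sibling a (c :: p)) xa sp /=.
  by rewrite sibling_sym; move: xb; rewrite bE.
by rewrite cons_uniq xp.
Qed.

Lemma branch_eq h i g h' :
  covers g h -> h' != h -> covers g h' -> connect (sibling_off h) h' i ->
  branch h i = g.
Proof.
move=> gh h'h gh' ci; rewrite /branch; case: pickP => [k|/(_ g)]; last first.
  by rewrite gh; case: existsP => // -[]; exists h'; rewrite h'h gh'.
case/andP=> kh /existsP[h2 /and3P[h2h kh2 ci2]] /=.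
have e : h' = h2.
  apply: (@sibling_off_uniq h).
  - by rewrite /sibling /= eq_sym h'h; apply/existsP; exists g; rewrite gh.
  - by rewrite /sibling /= eq_sym h2h; apply/existsP; exists k; rewrite kh.
  - by apply: connect_trans ci _; rewrite connect_sibling_off_sym.
by apply: (covers_uniq vineP h2h); rewrite // -e.
Qed.

Lemma path_sibling_off h y p : uniq (h :: y :: p) -> path sibling y p ->
  path (sibling_off h) y p.
Proof.
elim: p y => //= z p IH y; rewrite !inE !negb_or => /andP[/and3P[hy hz hp] /andP[_ uz]].
move=> /andP[yz /IH]; rewrite /sibling_off /= yz eq_sym hy eq_sym hz /=.
by apply; rewrite inE negb_or hz hp.
Qed.

Lemma branchP h i : h != i -> connect sibling h i ->
  exists h', [/\ sibling h h', covers (branch h i) h, covers (branch h i) h'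
    & connect (sibling_off h) h' i].
Proof.
move=> hi /connectP[p0 p0P]; case/shortenP: p0P => p pp up _ iE {p0}.
case: p => [|a p] in pp up iE *; first by rewrite iE eqxx in hi.
move: pp => /= /andP[ha ap].
have ci : connect (sibling_off h) a i.
  by apply/connectP; exists p => //; apply: path_sibling_off.
exists a; case/andP: (ha) => ha' /existsP[g /andP[gh ga]].
by rewrite (@branch_eq _ _ g a) // eq_sym.
Qed.

Lemma branch_covers h i : h != i -> connect sibling h i -> covers (branch h i) h.
Proof. by move=> hi /(branchP hi)[h' []]. Qed.

Lemma branch_off h i j : connect (sibling_off h) i j -> h != i ->
  connect sibling h i -> branch h i = branch h j.
Proof.
move=> cij hi /(branchP hi)[h' [hh' c1 c2 cc]]; symmetry; apply: branch_eq c1 _ c2 _.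
  by rewrite eq_sym; case/andP: hh'.
exact: connect_trans cc cij.
Qed.

Lemma path_mem_off h x p : path sibling x p -> h \notin x :: p ->
  connect (sibling_off h) x (last x p).
Proof.
elim: p x => [|y p IH] x /=; first by rewrite connect0.
rewrite !inE !negb_or => /andP[xy yp] /and3P[hx hy hp].
apply: (@connect_trans _ _ y); last by apply: IH; rewrite // inE negb_or hy.
by apply: connect1; rewrite /sibling_off /= xy eq_sym hx eq_sym hy.
Qed.

(* The last hypothesis says that [h] lies between [a] and [b]. *)
Lemma branch_between h a b : h != a -> h != b -> a != b -> connect sibling h a ->
  connect sibling h b -> branch h a != branch h b -> branch b h = branch b a.
Proof.
move=> ha hb ab ca cb /eqP nab; apply: branch_off; last 2 first.
- by rewrite eq_sym.
- by rewrite connect_sibling_sym.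
case/connectP: ca => p0 p0P aE0; case/shortenP: p0P aE0 => p pp up _ aE {p0}.
have [|bp] := boolP (b \in h :: p); last by rewrite aE; apply: path_mem_off.
rewrite inE eq_sym (negPf hb) /= => /splitPr bp.
case: bp pp up aE => p1 p2; rewrite cat_path last_cat cons_uniq /=.
rewrite mem_cat inE !negb_or => /and3P[_ _ bp2] /andP[/and3P[_ _ hp2] _] aE.
case: nab; symmetry; apply: branch_off; rewrite // aE.
by apply: path_mem_off; rewrite // inE negb_or hb.
Qed.

(** A common first edge would be the edge between [h1] and [h2]. Then [h1] has a way to [i] avoiding
    [h2], and [h2] one avoiding [h1], so two neighbours of [h1] stay connected after deleting
    [h1]. *)
Lemma branch_inj h1 h2 i : h1 != i -> h2 != i -> connect sibling h1 i ->
  connect sibling h2 i -> branch h1 i = branch h2 i -> h1 = h2.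
Proof.
move=> h1i h2i c1 c2 e; apply/eqP/negPn/negP => h12.
have [a1 [s1 g1 ga1 o1]] := branchP h1i c1.
have [a2 [s2 g2 ga2 o2]] := branchP h2i c2; rewrite -e in g2 ga2.
have ea1 : a1 = h2.
  case: (covered_pair vineP h12 g1 g2 ga1) => // a1E.
  by move: s1; rewrite a1E /sibling /= eqxx.
have ea2 : a2 = h1.
  case: (covered_pair vineP h12 g1 g2 ga2) => // a2E.
  by move: s2; rewrite a2E /sibling /= eqxx.
subst a1 a2; case/connectP: o2 => p0 p0P iE0.
case/shortenP: p0P iE0 => p pp up _ iE {p0}.
case: p => [|b p] in pp up iE *; first by rewrite iE eqxx in h1i.
move: pp => /= /andP[/and3P[h1b _ bh2] bp].
have sp : path sibling b p by apply: sub_path bp; apply: sibling_off_sub.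
suff : h2 = b by move=> e2; rewrite e2 eqxx in bh2.
apply: (sibling_off_uniq s1 h1b); apply: connect_trans o1 _.
by rewrite connect_sibling_off_sym iE; apply: path_mem_off => //; case/andP: up.
Qed.

Hypothesis icP : ideals_connected P.

Lemma ideal_connect w x y : x <= w -> y <= w -> rk x = rk y -> connect sibling x y.
Proof.
move=> xw yw rxy; move: (icP xw yw rxy); apply: connect_sub => a b /sibling_in_sub.
exact: connect1.
Qed.

Lemma sibling_in_le w x y : sibling_in w x y -> x <= w /\ y <= w.
Proof.
case/andP=> _ /existsP[v /and3P[vw /covers_le xv /covers_le yv]].
by rewrite (le_trans xv) ?(le_trans yv).
Qed.

Lemma path_sibling_in_le w x p : path (sibling_in w) x p -> x <= w ->
  all (fun y => y <= w) (x :: p).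
Proof.
elim: p x => [|y p IH] x /=; first by move=> _ ->.
by case/andP=> /sibling_in_le[xw yw] /IH /(_ yw) /= -> _; rewrite xw.
Qed.

(** The ideal of [w] contains a way from [x] to [y]; in a forest there is only one, so its first
    edge is the branch. *)
Lemma branch_le w x y : x != y -> rk x = rk y -> x <= w -> y <= w -> branch x y <= w.
Proof.
move=> xy rxy xw yw; case/connectP: (icP xw yw rxy) => p0 p0P.
case/shortenP: p0P => p pp up _ yE {p0}.
case: p => [|a p] in pp up yE *; first by rewrite yE eqxx in xy.
move: pp => /= /andP[/andP[xa /existsP[g /and3P[gw gx ga]]] ap].
rewrite (@branch_eq _ _ g a) // 1?eq_sym//.
apply/connectP; exists p => //; apply: path_sibling_off => //.
by apply: sub_path ap; apply: sibling_in_sub.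
Qed.

(** Different branches mean that [h] separates [i] from [j], so the way inside the ideal of [w]
    meets [h]. *)
Lemma between_le w h i j : h != i -> connect sibling h i -> i <= w -> j <= w ->
  rk i = rk j -> branch h i != branch h j -> h <= w.
Proof.
move=> hi chi iw jw rij /eqP nb; case/connectP: (icP iw jw rij) => p pp jE.
have [hp|hp] := boolP (h \in i :: p).
  by move/allP: (path_sibling_in_le pp iw) => /(_ _ hp).
case: nb; apply: branch_off => //; rewrite jE; apply: path_mem_off => //.
by apply: sub_path pp; apply: sibling_in_sub.
Qed.

Lemma is_joinP x y z :
  reflect [/\ x <= z, y <= z & forall w, x <= w -> y <= w -> z <= w] (is_join x y z).
Proof.
apply: (iffP and3P) => -[xz yz H]; split=> //.
  by move=> w xw yw; move/forallP: H => /(_ w); rewrite xw yw.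
by apply/forallP => w; apply/implyP => /andP[]; apply: H.
Qed.

(** By [branch_le] the pair one level up has the same common upper bounds. *)
Lemma join_branch x y z : x != y -> rk x = rk y ->
  is_join x y z -> is_join (branch x y) (branch y x) z.
Proof.
move=> xy rxy /is_joinP[xz yz zmin].
have c : connect sibling x y by apply: ideal_connect xz yz rxy.
have xb : x <= branch x y by apply/covers_le/branch_covers.
have yb : y <= branch y x.
  by apply/covers_le/branch_covers; rewrite 1?eq_sym // connect_sibling_sym.
apply/is_joinP; split.
- exact: branch_le.
- by apply: branch_le; rewrite // eq_sym.
- by move=> w fw gw; apply: zmin; [apply: le_trans fw|apply: le_trans gw].
Qed.

(** Replacing the pair by its two branches keeps the common upper bounds and raises the rank; as
    ranks are bounded, the two elements finally coincide. *)
Lemma join_exists x y w : rk x = rk y -> x <= w -> y <= w -> exists z, is_join x y z.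
Proof.
have [n] := ubnP (poset_rank P - rk x); elim: n x y => // n IH x y ltn rxy xw yw.
have [<-|xy] := eqVneq x y; first by exists x; apply/is_joinP; split.
have c := ideal_connect xw yw rxy.
have cx := branch_covers xy c.
have cy : covers (branch y x) y.
  by apply: branch_covers; rewrite 1?eq_sym // connect_sibling_sym.
have fw : branch x y <= w by apply: branch_le.
have gw : branch y x <= w by apply: branch_le; rewrite // eq_sym.
have [||z /is_joinP[fz gz zmin]] := IH _ _ _ _ fw gw.
- have lt : (rk x < poset_rank P)%N.
    by apply: leq_trans (rk_le_poset_rank (branch x y)); rewrite (rk_covers vineP cx).
  by rewrite (rk_covers vineP cx); move: ltn; rewrite -(subnSK lt) ltnS.
- by rewrite (rk_covers vineP cx) (rk_covers vineP cy) rxy.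
exists z; apply/is_joinP; split.
- exact: le_trans (covers_le cx) fz.
- exact: le_trans (covers_le cy) gz.
- by move=> u xu yu; apply: zmin; apply: branch_le; rewrite // eq_sym.
Qed.

(** An element lying between the other two is below their join by [between_le]. Otherwise each
    element has a single branch towards the other two, and the three branches repeat the situation
    one level up. *)
Lemma three_joins x y h zxy zyh zxh : rk x = rk y -> rk y = rk h ->
  is_join x y zxy -> is_join y h zyh -> is_join x h zxh ->
  [\/ h <= zxy, x <= zyh | y <= zxh].
Proof.
have [n] := ubnP (poset_rank P - rk x); elim: n x y h => // n IH x y h ltn rxy ryh Jxy Jyh Jxh.
have /is_joinP[xzxy yzxy _] := Jxy; have /is_joinP[yzyh hzyh _] := Jyh.
have /is_joinP[xzxh hzxh _] := Jxh; have rxh := etrans rxy ryh.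
have [e|xy] := eqVneq x y; first by apply: Or33; rewrite -e.
have [e|yh] := eqVneq y h; first by apply: Or33; rewrite e.
have [e|xh] := eqVneq x h; first by apply: Or31; rewrite -e.
have cxy := ideal_connect xzxy yzxy rxy; have cyh := ideal_connect yzyh hzyh ryh.
have cxh := ideal_connect xzxh hzxh rxh.
have [ex|nx] := eqVneq (branch x y) (branch x h); last first.
  by apply: Or32; apply: between_le nx.
have [ey|ny] := eqVneq (branch y x) (branch y h); last first.
  by apply: Or33; apply: between_le ny => //; rewrite 1?eq_sym // connect_sibling_sym.
have [eh|nh] := eqVneq (branch h x) (branch h y); last first.
  by apply: Or31; apply: between_le nh => //; rewrite 1?eq_sym // connect_sibling_sym.
have cx := branch_covers xy cxy; have cy := branch_covers yh cyh.
have ch : covers (branch h x) h.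
  by apply: branch_covers; rewrite 1?eq_sym // connect_sibling_sym.
have := IH (branch x y) (branch y h) (branch h x).
rewrite !(rk_covers vineP cx, rk_covers vineP cy, rk_covers vineP ch) -ryh -rxy.
case=> //.
- have lt : (rk x < poset_rank P)%N.
    by apply: leq_trans (rk_le_poset_rank (branch x y)); rewrite (rk_covers vineP cx).
  by move: ltn; rewrite -(subnSK lt) ltnS.
- by rewrite -ey; apply: join_branch.
- by rewrite eh; apply: join_branch.
- by rewrite ex; apply: join_branch.
- by move=> H; apply: Or31; apply: le_trans H; apply: covers_le.
- by move=> H; apply: Or32; apply: le_trans H; apply: covers_le.
- by move=> H; apply: Or33; apply: le_trans H; apply: covers_le.
Qed.

(** Models a path of [n] edges of equal label, [r] being the rank of the joins. The rank [m] of the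
    terms is a parameter so that a chain can be lifted level by level. *)
Definition join_chain r m n (x K : nat -> P) : Prop :=
  [/\ forall t, (t <= n)%N -> rk (x t) = m,
      forall t, (t < n)%N -> is_join (x t) (x t.+1) (K t),
      forall t, (t < n)%N -> rk (K t) = r
    & forall t, (t.+1 < n)%N -> K t != K t.+1].

Lemma join_chain_sub r m n (x K : nat -> P) s l : join_chain r m n x K -> (s + l <= n)%N ->
  join_chain r m l (fun t => x (s + t)%N) (fun t => K (s + t)%N).
Proof.
case=> h1 h2 h3 h4 sl.
split=> t tl; rewrite ?addnS; [apply: h1|apply: h2|apply: h3|apply: h4];
  by apply: leq_trans sl; rewrite -?addnS leq_add2l.
Qed.

(* [J] contains the way from [x 0] to [x n]. If this way leaves some [x t] in
   different directions on the two sides, then [x t] lies below [J] and the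
   chain splits; otherwise the whole chain lifts to the next level. *)
Lemma join_chain_bound r m n (x K : nat -> P) J : (0 < n)%N -> join_chain r m n x K ->
  (rk J <= r)%N -> x 0%N <= J -> x n <= J -> n = 1%N.
Proof.
have [d] := ubnP (r - m).
elim: d m n x K J => // d IHd m n x K J ltd n0 ch rJ x0J xnJ.
have [//|n1] := eqVneq n 1%N.
(* If the joins did not outrank the terms, the first two joins would both equal the term they
   share. *)
have mr : (m < r)%N.
  have n2 : (1 < n)%N by rewrite ltn_neqAle eq_sym n1.
  have [h1 h2 h3 h4] := ch; have := h2 _ n2; have := h2 _ n0.
  move=> /is_joinP[_ k0 _] /is_joinP[k1 _ _].
  rewrite ltnNge; apply/negP => rm; case/negP: (h4 _ n2).
  by rewrite -(le_rk_eq vineP k0) ?(h1, h3)// -(le_rk_eq vineP k1) ?(h1, h3).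
(* The inner induction on [n] needs more: at each end, the branch towards the far end is the one
   towards the neighbouring term, and a [J] bounding both ends is [K 0]. *)
suff H : forall n (x K : nat -> P), (0 < n)%N -> join_chain r m n x K ->
  [/\ x 0%N != x n, connect sibling (x 0%N) (x n),
      branch (x 0%N) (x n) = branch (x 0%N) (x 1%N),
      branch (x n) (x 0%N) = branch (x n) (x n.-1)
    & forall J, (rk J <= r)%N -> x 0%N <= J -> x n <= J -> n = 1%N /\ J = K 0%N].
  by have [_ _ _ _ /(_ J rJ x0J xnJ)[]] := H _ _ _ n0 ch.
move=> {ch rJ x0J xnJ n1 n0} {}n {}x {}K.
have [l] := ubnP n; elim: l n x K => // l IH n x K ltn n0 ch {J}.
have [h1 h2 h3 h4] := ch.
have sub s k : (0 < k)%N -> (s + k <= n)%N -> (k < n)%N -> _ :=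
  fun k0 sk kn => IH _ _ _ (leq_trans kn ltn) k0 (join_chain_sub ch sk).
have xK t : (t < n)%N -> x t <= K t by move=> /h2/is_joinP[].
have xK' t : (t < n)%N -> x t.+1 <= K t by move=> /h2/is_joinP[].
have r2 s t : (s <= n)%N -> (t <= n)%N -> rk (x s) = rk (x t).
  by move=> sn tn; rewrite !h1.
have step t : (t < n)%N -> x t != x t.+1 /\ connect sibling (x t) (x t.+1).
  move=> tn; split; last by apply: ideal_connect (xK _ tn) (xK' _ tn) (r2 _ _ _ _) => //; apply: ltnW.
  apply/eqP => e; have /is_joinP[_ _ kmin] := h2 _ tn.
  have := rk_le vineP (kmin (x t.+1) _ _).
  by rewrite h3 // h1 // -e lexx leqNgt mr => /(_ isT isT).
have [n1|n1] := eqVneq n 1%N.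
  subst n; have [ne c] := step _ n0; split=> // J rJ j0 j1; split=> //.
  have /is_joinP[_ _ kmin] := h2 _ n0.
  by apply/esym/(le_rk_eq vineP); [apply: kmin | rewrite h3].
have n2 : (1 < n)%N by rewrite ltn_neqAle eq_sym n1.
have nn : n.-1.+1 = n by rewrite prednK.
have nltn : (n.-1 < n)%N by rewrite nn.
have n10 : (0 < n.-1)%N by rewrite -ltnS nn.
have [a1 a2 a3 a4 a5] := sub 0%N n.-1 n10 (ltnW nltn) nltn.
have [b1 b2 b3 b4 b5] := sub 1%N n.-1 n10 (eq_leq nn) nltn.
rewrite /= !add0n in a1 a2 a3 a4 a5; rewrite /= !addn0 !add1n nn in b1 b2 b3 b4 b5.
(* Otherwise the claim for the chain without its last term, with [K n.-1] as [J], gives [n = 2] and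
   [K 1 = K 0]. *)
have notK0 : ~~ (x 0%N <= K n.-1).
  apply/negP => /a5; rewrite xK // h3 // => /(_ (leqnn _) isT)[e1 e2].
  by have := h4 0%N n2; rewrite -e2 e1 eqxx.
have notKn : ~~ (x n <= K 0%N).
  apply/negP => xn; have := b5 (K 0%N); rewrite h3 // xK' // xn.
  move=> /(_ (leqnn _) isT isT)[e1 e2].
  by have := h4 0%N n2; rewrite e2 eqxx.
have xKn : x n <= K n.-1 by rewrite -{1}nn; apply: xK'.
have ne : x 0%N != x n by apply: contraNneq notK0 => ->.
have c : connect sibling (x 0%N) (x n).
  by apply: connect_trans a2 _; rewrite -{2}nn; case: (step _ nltn).
have c' : connect sibling (x n) (x 0%N) by rewrite connect_sibling_sym.
(* If this failed, [x 0] would lie between [x n.-1] and [x n], hence below their join, against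
   [notK0]. *)
have e0 : branch (x 0%N) (x n) = branch (x 0%N) (x 1%N).
  rewrite -a3; apply/eqP/negPn/negP => nb.
  by move/negP: notK0; apply; apply: between_le nb => //; [apply: xK|apply: r2; rewrite ?leq_pred].
have en : branch (x n) (x 0%N) = branch (x n) (x n.-1).
  rewrite prednK // in b4; rewrite -b4.
  apply/eqP/negPn/negP => nb.
  move/negP: notKn; apply; apply: between_le nb => //; [by rewrite eq_sym|exact: xK|exact: xK'|].
  by apply: r2.
split=> // J rJ x0J xnJ; exfalso.
(* Otherwise [x t] lies below [J]; the claim for the two halves makes each a single step with join
   [J], so [K 0 = K 1]. *)
have turn t : (0 < t)%N -> (t < n)%N -> branch (x t) (x t.-1) = branch (x t) (x t.+1).
  move=> t0 tn; have nt0 : (0 < n - t)%N by rewrite subn_gt0.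
  have ntn : (n - t < n)%N by rewrite ltn_subrL t0.
  have tnn : (t + (n - t) = n)%N by rewrite subnKC // ltnW.
  have [c1 c2 _ c4 c5] := sub 0%N t t0 (ltnW tn) tn.
  have [d1 d2 d3 _ d5] := sub t (n - t)%N nt0 (eq_leq tnn) ntn.
  rewrite /= !add0n in c1 c2 c4 c5; rewrite /= !addn0 !addn1 !tnn in d1 d2 d3 d5.
  rewrite -c4 -d3; apply/eqP/negPn/negP => nb.
  have xtJ : x t <= J.
    apply: between_le nb => //; rewrite 1?eq_sym // 1?connect_sibling_sym //.
    exact: r2.
  have [t1 J0] := c5 J rJ x0J xtJ; have [_ J1] := d5 J rJ xtJ xnJ.
  by have := h4 0%N n2; rewrite -J0 J1 t1 eqxx.
(* The lifted chain: forward branches, except at the last term, which only has a backward one. By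
   [turn] both directions agree at inner terms, so the joins stay the same. *)
pose y t := if (t < n)%N then branch (x t) (x t.+1) else branch (x t) (x t.-1).
have yS t : (t < n)%N -> y t.+1 = branch (x t.+1) (x t).
  rewrite /y => tn; case: ifP => // tn'; by rewrite -turn.
have y0 : y 0%N = branch (x 0%N) (x 1%N) by rewrite /y n0.
have yn : y n = branch (x n) (x n.-1) by rewrite /y ltnn.
have yt t : (t < n)%N -> y t = branch (x t) (x t.+1) by rewrite /y => ->.
have cov t : (t <= n)%N -> covers (y t) (x t).
  rewrite leq_eqVlt => /predU1P[->|tn].
    by rewrite yn -en; apply: branch_covers; rewrite // eq_sym.
  by rewrite yt //; have [s1 s2] := step _ tn; apply: branch_covers.
suff : n = 1%N by move=> n1'; rewrite n1' in n1.
apply: (IHd m.+1 n y K J) => //.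
- by move: ltd; rewrite -(subnSK mr) ltnS.
- split=> //; first by move=> t tn; rewrite (rk_covers vineP (cov _ tn)) h1.
  move=> t tn; rewrite yS // yt //; apply: join_branch.
  + by case: (step _ tn).
  + by apply: r2; rewrite // ltnW.
  + exact: h2.
- by rewrite y0 -e0; apply: branch_le => //; apply: r2.
- by rewrite yn -en; apply: branch_le; rewrite // 1?eq_sym //; apply: r2.
Qed.

(** * Common neighbours of a pair without upper bound *)

Definition bounded x y := [exists w, (x <= w) && (y <= w)].

Lemma boundedP x y : reflect (exists2 w, x <= w & y <= w) (bounded x y).
Proof. by apply: (iffP existsP) => -[w] => [/andP[]|a b]; exists w => //; apply/andP. Qed.

Definition common_neighbours u v :=
  [set h | [&& rk h == rk u, bounded u h & bounded h v]].

(* Passing to the edges [branch u v] and [branch v u] one level up, and from a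
   common neighbour [h] to [branch h u], loses at most one common neighbour. *)
Lemma common_neighbours_top k d u v :
  (forall x, rk x <= k)%N -> (rk u + d.+1)%N = k -> rk v = rk u -> ~~ bounded u v ->
  (d < #|common_neighbours u v|)%N ->
  exists A B D, [/\ rk A = k, covers A D, covers B D, u <= A & v <= B].
Proof.
move=> maxk; elim: d u v => [|d IH] u v ud rvu nuv.
  (* For [d = 0] the pair has rank [k - 1], so the bounds linking a common neighbour [h] to [u] and
     to [v] have rank [k] and cover [h], which serves as [D]. *)
  case/card_gt0P => h; rewrite inE => /and3P[/eqP rh].
  move=> /boundedP[A uA hA] /boundedP[B hB vB].
  rewrite addn1 in ud.
  have cov z w : rk z = rk u -> z < w -> covers w z.
    by move=> rz zw; apply: (lt_covers vineP) => //; rewrite rz ud.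
  have hA' : covers A h.
    apply: cov => //; rewrite lt_neqAle hA andbT; apply: contraNneq nuv => hA'.
    by apply/boundedP; exists B => //; rewrite (le_trans uA) // -hA'.
  have hB' : covers B h.
    apply: cov => //; rewrite lt_neqAle hB andbT; apply: contraNneq nuv => hB'.
    by apply/boundedP; exists A => //; rewrite (le_trans vB) // -hB'.
  by exists A, B, h; split=> //; rewrite (rk_covers vineP hA') rh.
set S := common_neighbours u v => dS.
pose f := branch u v; pose g := branch v u; pose p h := branch h u.
have inS h : h \in S -> [/\ h != u, h != v, rk h = rk u,
    connect sibling h u & connect sibling h v].
  rewrite inE => /and3P[/eqP rh hu hv].
  split=> //.
  - by apply: contraNneq nuv => <-.
  - by apply: contraNneq nuv => <-.
  - by case/boundedP: hu => w uw hw; apply: ideal_connect hw uw rh.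
  - by case/boundedP: hv => w hw vw; apply: ideal_connect hw vw _; rewrite rvu.
have uv : u != v.
  case/card_gt0P: (leq_ltn_trans (leq0n _) dS) => h.
  rewrite inE => /and3P[_ /boundedP[w uw _] _].
  by apply: contraNneq nuv => <-; apply/boundedP; exists w.
have cuv : connect sibling u v.
  case/card_gt0P: (leq_ltn_trans (leq0n _) dS) => h /inS[_ _ _ hu hv].
  by apply: connect_trans hv; rewrite connect_sibling_sym.
have cvu : connect sibling v u by rewrite connect_sibling_sym.
have uf : covers f u by apply: branch_covers.
have vg : covers g v by apply: branch_covers; rewrite // eq_sym.
(* The branch at [u] towards [v] is also the one towards [h]: otherwise [u] lies between [h] and
   [v], and a bound of these two bounds [u] and [v]. *)
have fle h w : h \in S -> u <= w -> h <= w -> f <= w /\ p h <= w.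
  move=> hS uw hw; have [hu hv rh chu chv] := inS _ hS; split; last exact: branch_le.
  suff -> : f = branch u h by apply: branch_le; rewrite // eq_sym.
  apply/eqP/negPn/negP => nb; move: (hS); rewrite inE => /and3P[_ _ /boundedP[w' hw' vw']].
  case/negP: nuv; apply/boundedP; exists w' => //.
  by apply: between_le vw' hw' _ nb; rewrite // rh.
have gle h w : h \in S -> h <= w -> v <= w -> g <= w.
  move=> hS hw vw; have [hu hv rh chu chv] := inS _ hS.
  suff -> : g = branch v h by apply: branch_le; rewrite // 1?eq_sym // rvu.
  apply/eqP/negPn/negP => nb; move: (hS); rewrite inE => /and3P[_ /boundedP[w' uw' hw'] _].
  case/negP: nuv; apply/boundedP; exists w' => //.
  by apply: between_le uw' hw' _ nb; rewrite // eq_sym.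
(* The common neighbours lost by the lift. By [inE'] they all lie between [u] and [v]. *)
pose E := [set h in S | ~~ bounded (p h) g].
have inE' h : h \in E -> h \in S /\ branch h u != branch h v.
  rewrite inE => /andP[hS nb]; split=> //; apply: contraNneq nb => e.
  have [hu hv rh chu chv] := inS _ hS.
  move: (hS); rewrite inE => /and3P[_ _ /boundedP[w hw vw]]; apply/boundedP; exists w.
    by rewrite /p e; apply: branch_le; rewrite // rh rvu.
  exact: gle hS hw vw.
(* Here [h2] lies between [u] and [v], and [h1] between [u] and [h2]. A bound of [h1] and [v] then
   also bounds [h2], its branch towards [u], and [g]. *)
have key h1 h2 : h1 != h2 -> h1 \in S -> h2 \in S -> branch h2 u != branch h2 v ->
    branch h1 u != branch h1 h2 -> bounded (p h2) g.
  move=> ne h1S h2S n2 n1.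
  have [hu1 hv1 rh1 chu1 chv1] := inS _ h1S; have [hu2 hv2 rh2 chu2 chv2] := inS _ h2S.
  have c12 : connect sibling h1 h2.
    by apply: connect_trans chu1 _; rewrite connect_sibling_sym.
  have e : branch h2 h1 = branch h2 u by apply: branch_between n1; rewrite // eq_sym.
  move: (h1S); rewrite inE => /and3P[_ _ /boundedP[w h1w vw]]; apply/boundedP; exists w.
    rewrite /p -e; apply: branch_le; rewrite // 1?eq_sym ?rh1 ?rh2 //.
    rewrite -e in n2; apply: between_le h1w vw _ n2.
    - by rewrite eq_sym.
    - by rewrite connect_sibling_sym.
    - by rewrite rh1 rvu.
  exact: gle h1S h1w vw.
(* Of two elements of [E], the one farther from [u] is excluded by [key]. *)
have E1 : (#|E| <= 1)%N.
  apply/card_le1_eqP => h2 h1 h2E h1E; apply/eqP/negPn/negP => ne.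
  have [h1S n1] := inE' _ h1E; have [h2S n2] := inE' _ h2E.
  have [hu1 hv1 rh1 chu1 chv1] := inS _ h1S; have [hu2 hv2 rh2 chu2 chv2] := inS _ h2S.
  have [e|n12] := eqVneq (branch h1 u) (branch h1 h2); last first.
    by case/setIdP: h2E => _ /negP; apply; apply: (key h1 h2).
  have c12 : connect sibling h1 h2.
    by apply: connect_trans chu1 _; rewrite connect_sibling_sym.
  have e' : branch h2 h1 = branch h2 v.
    have n12 : branch h1 v != branch h1 h2 by rewrite -e eq_sym.
    by apply: branch_between n12; rewrite // eq_sym.
  by case/setIdP: h1E => _ /negP; apply; apply: (key h2 h1); rewrite ?e' // eq_sym.
have rf : rk f = (rk u).+1 by rewrite (rk_covers vineP uf).
have [||||A [B [D [rA AD BD fA gB]]]] := IH f g.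
- by rewrite rf -ud addSnnS.
- by rewrite rf (rk_covers vineP vg) rvu.
- apply: contra nuv => /boundedP[w fw gw]; apply/boundedP; exists w.
    exact: le_trans (covers_le uf) fw.
  exact: le_trans (covers_le vg) gw.
- have injp : {in S :\: E &, injective p}.
    move=> h1 h2 /setDP[/inS[a1 _ _ a2 _] _] /setDP[/inS[b1 _ _ b2 _] _].
    exact: branch_inj.
  apply: (@leq_trans #|S :\: E|).
    rewrite cardsD; apply: leq_trans (leq_sub2l _ (_ : _ <= 1)%N).
      by rewrite ltn_subRL add1n.
    by apply: leq_trans E1; apply/subset_leq_card/subsetIr.
  rewrite -(card_in_imset injp); apply/subset_leq_card/subsetP => _ /imsetP[h hSE ->].
  have [hS hE] := setDP hSE; have [hu hv rh chu chv] := inS _ hS.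
  rewrite inE rf (rk_covers vineP (branch_covers hu chu)) rh eqxx /=; apply/andP; split.
    move: (hS); rewrite inE => /and3P[_ /boundedP[w uw hw] _].
    by have [fw pw] := fle _ _ hS uw hw; apply/boundedP; exists w.
  by move: hE; rewrite inE hS negbK.
exists A, B, D; split=> //.
- exact: le_trans (covers_le uf) fA.
- exact: le_trans (covers_le vg) gB.
Qed.

End VineTheory.

(** * Principal ideals and a criterion for LR-vines *)

Section Ideals.
Local Open Scope order_scope.
Variable P : ranked_poset.
Hypothesis vineP : vine P.
Implicit Types (u v w x y z : P).

Definition atoms v : {set P} := [set x | minimal x && (x <= v)].

Lemma ideal_lt v (x y : principal_ideal v) : (x < y) = (val x < val y).
Proof. exact: esym (lt_val x y). Qed.

Lemma ideal_covers v (x y : principal_ideal v) : covers x y = covers (val x) (val y).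
Proof.
rewrite /covers ideal_lt; congr (_ && ~~ _).
apply/existsP/existsP => -[z /andP[yz zx]].
  by exists (val z); move: yz zx; rewrite !ideal_lt => ->.
have zv : z <= v by apply: ltW (lt_le_trans zx (valP x)).
by exists (Sub z zv); rewrite !ideal_lt /= yz.
Qed.

Lemma ideal_minimal v (x : principal_ideal v) : minimal x = minimal (val x).
Proof.
apply/forallP/forallP => H y; last by rewrite ideal_lt.
apply/negP => yx; have yv : y <= v by apply: ltW (lt_le_trans yx (valP x)).
by have := H (Sub y yv); rewrite ideal_lt SubK yx.
Qed.

Lemma ideal_sibling v (x y : principal_ideal v) :
  sibling x y = sibling_in v (val x) (val y).
Proof.
rewrite /sibling /sibling_in /= (inj_eq val_inj); congr (_ && _).
apply/existsP/existsP => -[z].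
  by rewrite !ideal_covers => /andP[zx zy]; exists (val z); rewrite zx zy (valP z).
by case/and3P=> zv zx zy; exists (Sub z zv); rewrite !ideal_covers SubK zx.
Qed.

Lemma vine_ideal v : vine (principal_ideal v).
Proof.
split.
- split=> [x|x y|x y|x]; first exact: (rk_gt0 vineP).
  + by rewrite ideal_lt => /(rk_lt vineP).
  + by rewrite ideal_covers => /(rk_covers vineP).
  + by rewrite ideal_minimal (minimalE vineP) => /eqP.
- move=> x; rewrite ideal_minimal => nm; have [_ /(_ _ nm) <- _ _] := vineP.
  rewrite -(card_imset _ val_inj); apply: eq_card => y; rewrite inE.
  apply/imsetP/idP => [[z zx ->]|yx]; first by rewrite inE ideal_covers in zx.
  have yv : y <= v by apply: le_trans (covers_le yx) (valP x).
  by exists (Sub y yv); rewrite ?SubK // inE ideal_covers SubK.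
- move=> x y a b xy _; rewrite !ideal_covers => ax ay bx by'.
  by apply: val_inj; apply: (covers_uniq vineP) ax ay bx by'; rewrite (inj_eq val_inj).
- move=> i _ c sz /andP[cc uc].
  apply: (@sibling_acyclic _ vineP (map val c)); first by rewrite size_map.
  rewrite /ucycle (map_inj_uniq val_inj) uc andbT.
  rewrite cycle_map; apply: sub_cycle cc => x y.
  case/and4P=> _ _ xy /imsetP[w _ xyE]; rewrite /sibling /= (inj_eq val_inj) xy.
  apply/existsP; exists (val w); rewrite -!ideal_covers.
  have : (x \in covered w) && (y \in covered w) by rewrite -xyE set21 set22.
  by rewrite !inE.
Qed.

Lemma ideal_poset_rank v : poset_rank (principal_ideal v) = rk v.
Proof.
apply/anti_leq/andP; split.
  by apply/bigmax_leqP => x _; apply: (rk_le vineP (valP x)).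
exact: (@rk_le_poset_rank (principal_ideal v) (exist _ v (lexx v))).
Qed.

Lemma ideal_poset_dim v : poset_dim (principal_ideal v) = #|atoms v|.
Proof.
rewrite /poset_dim -(card_imset _ val_inj); apply: eq_card => y; rewrite inE.
apply/imsetP/andP => [[z zm ->]|[my yv]].
  by rewrite inE ideal_minimal in zm; rewrite zm (valP z).
by exists (Sub y yv); rewrite ?SubK // inE ideal_minimal SubK.
Qed.

Lemma ideal_level_adj v k (x y : principal_ideal v) :
  level_adj k x y = (rk (val x) == k) && sibling_in v (val x) (val y).
Proof. by rewrite (level_adjP (vine_ideal v)) ideal_sibling. Qed.

Lemma LR_vine_connected : LR_vine P -> ideals_connected P.
Proof.
case=> _ H w x y xw yw rxy; have [_ _ tree _] := H w.
have rI : (1 <= rk x <= poset_rank (principal_ideal w))%N.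
  by rewrite (rk_gt0 vineP) ideal_poset_rank (rk_le vineP).
have [_ _ /(_ (Sub x xw) (Sub y yw))] := tree _ rI.
rewrite !inE /= eqxx rxy => /(_ isT (eqxx _)) /connectP[p pp yE].
apply/connectP; exists (map val p).
  rewrite (path_map (Sub x xw : principal_ideal w)).
  by apply: sub_path pp => a b; rewrite ideal_level_adj => /andP[].
by have := congr1 val yE; rewrite -(last_map val).
Qed.

Lemma LR_vine_dim v : LR_vine P -> #|atoms v| = rk v.
Proof. by case=> _ /(_ v)[_]; rewrite ideal_poset_dim ideal_poset_rank. Qed.

Lemma sibling_in_mono v w : v <= w -> subrel (sibling_in v) (sibling_in w).
Proof.
move=> vw x y /andP[xy /existsP[g /and3P[gv gx gy]]].
by rewrite /sibling_in /= xy; apply/existsP; exists g; rewrite (le_trans gv vw) gx.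
Qed.

Lemma ex_rk_below w k : (0 < k <= rk w)%N -> exists2 z, z <= w & rk z = k.
Proof.
have [n] := ubnP (rk w); elim: n w => // n IH w ltn /andP[k0].
rewrite leq_eqVlt => /predU1P[->|kw]; first by exists w.
have [a [_ [_ wa _ _]]] := ex_covered vineP (leq_ltn_trans k0 kw).
have rw := rk_covers vineP wa.
have [|| z za zk] := IH a; first by rewrite -ltnS -rw.
  by rewrite k0 -ltnS -rw.
by exists z => //; apply: le_trans za (covers_le wa).
Qed.

(** Induction on the rank of [w]. If [x] and [y] lie below distinct elements [a] and [b] covered by
    [w], proximity gives a [c] covered by both; an element of the right rank below [c] links [x] to
    [y] through the ideals of [a] and [b]. *)
Lemma proximity_connected : proximity P -> ideals_connected P.
Proof.
move=> prox w; have [n] := ubnP (rk w); elim: n w => // n IH w ltn x y xw yw rxy.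
have lt t : covers w t -> (rk t < n)%N.
  by move=> wt; rewrite -ltnS -(rk_covers vineP wt).
have sub a : covers w a -> x <= a -> forall z, z <= a -> rk x = rk z ->
    connect (sibling_in w) x z.
  move=> wa xa z za rxz.
  have := IH a (lt _ wa) x z xa za rxz.
  by apply: connect_sub => s t /(sibling_in_mono (covers_le wa))/connect1.
move: (xw) (yw); rewrite le_eqVlt => /predU1P[xE|xw'].
  by rewrite (le_rk_eq vineP yw) -?rxy xE ?connect0.
rewrite le_eqVlt => /predU1P[yE|yw'].
  by rewrite (le_rk_eq vineP xw) ?rxy yE ?connect0.
have [a wa xa] := ex_covers vineP xw'; have [b wb yb] := ex_covers vineP yw'.
have [ab|ab] := eqVneq a b; first by apply: sub wa xa _ _ rxy; rewrite ab.
have rab : rk a = rk b.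
  by have := rk_covers vineP wa; rewrite (rk_covers vineP wb) => -[].
(* In the first case [x = a] and [y = b] are siblings through [w] itself. *)
have [rxa|rxa] := leqP (rk a) (rk x).
  rewrite (le_rk_eq vineP xa rxa) (le_rk_eq vineP yb) -?rxy -?rab //.
  by apply: connect1; rewrite /sibling_in /= ab; apply/existsP; exists w; rewrite lexx wa.
have [c [ac bc]] : exists c, covers a c /\ covers b c.
  by apply: prox; rewrite ?(leq_ltn_trans (rk_gt0 vineP x) rxa)//; exists w.
have [|z zc rz] := @ex_rk_below c (rk x).
  by rewrite (rk_gt0 vineP) -ltnS -(rk_covers vineP ac).
apply: (@connect_trans _ _ z).
  by apply: sub wa xa _ _ _; rewrite // (le_trans zc) ?covers_le.
have := IH b (lt _ wb) z y (le_trans zc (covers_le bc)) yb; rewrite rz => /(_ rxy).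
by apply: connect_sub => s t /(sibling_in_mono (covers_le wb))/connect1.
Qed.

(** Ideals inherit the forests and proximity, and [proximity_connected] turns the forests into
    trees; only the count of atoms remains. *)
Lemma LR_vine_intro : proximity P -> (forall v, #|atoms v| = rk v) -> LR_vine P.
Proof.
move=> prox dim; split=> // v; split.
- exact: vine_ideal.
- by rewrite ideal_poset_rank ideal_poset_dim dim.
- move=> i; rewrite ideal_poset_rank => irk; split.
  + have [z zv rz] := ex_rk_below irk; apply/set0Pn; exists (Sub z zv).
    by rewrite inE /= rz.
  + have [_ _ _] := vine_ideal v; apply; by rewrite ideal_poset_rank.
  + move=> x y; rewrite !inE /= => /eqP rx /eqP ry.
    have /connectP[p] := proximity_connected prox (valP x) (valP y) (etrans rx (esym ry)).
    elim: p x rx => [|z p IH] x rx /=; first by move=> _ /val_inj->.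
    case/andP=> xz zp yE; have [_ zv] := sibling_in_le xz.
    have rz := sibling_rk vineP (sibling_in_sub xz); rewrite rx in rz.
    apply: (@connect_trans _ _ (Sub z zv)); last by apply: IH.
    by apply: connect1; rewrite ideal_level_adj rx eqxx.
- move=> x y xy rxy rx [w [wx wy]].
  have [||a [xa ya]] := prox (val x) (val y) _ rxy rx; first by rewrite (inj_eq val_inj).
    by exists (val w); rewrite -!ideal_covers.
  have av : a <= v by apply: le_trans (covers_le xa) (valP x).
  by exists (Sub a av); rewrite !ideal_covers.
Qed.

End Ideals.

(** * The MAT-labeling of Omega *)

Section OmegaMAT.
Local Open Scope order_scope.
Variable P : LR_vine_poset.
Implicit Types (a b v w x y z : P) (i j h : omega P).

Lemma LR_vineP : vine P.
Proof. by case: (LR_vine_posetP P). Qed.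
Let V := LR_vineP.

Lemma LR_connected : ideals_connected P.
Proof. exact: (LR_vine_connected V (LR_vine_posetP P)). Qed.
Let IC := LR_connected.

Lemma card_atoms v : #|atoms v| = rk v.
Proof. exact: (LR_vine_dim V v (LR_vine_posetP P)). Qed.

Lemma join_uniq x y z w : is_join x y z -> is_join x y w -> z = w.
Proof.
move=> /is_joinP[xz yz zmin] /is_joinP[xw yw wmin].
by apply/le_anti; rewrite zmin // wmin.
Qed.

Lemma minimal_rk x : minimal x -> rk x = 1%N.
Proof. by rewrite (minimalE V) => /eqP. Qed.

Lemma minimal_join x y w : minimal x -> minimal y -> x <= w -> y <= w ->
  exists2 z, is_join x y z & z <= w.
Proof.
move=> /minimal_rk rx /minimal_rk ry xw yw.
have [z zP] := join_exists V IC (etrans rx (esym ry)) xw yw; exists z => //.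
by case/is_joinP: zP => _ _; apply.
Qed.

Lemma atoms_mono v w : v <= w -> atoms v \subset atoms w.
Proof.
by move=> vw; apply/subsetP => x; rewrite !inE => /andP[-> /le_trans->].
Qed.

Lemma card_atoms_covers v a : covers v a -> #|atoms v :\: atoms a| = 1%N.
Proof.
move=> va; rewrite cardsD (setIidPr (atoms_mono (covers_le va))) !card_atoms.
by rewrite (rk_covers V va) subSnn.
Qed.

Lemma join_minimal_lt x y z : minimal x -> minimal y -> x != y -> is_join x y z -> x < z.
Proof.
move=> mx my xy /is_joinP[xz yz _]; rewrite lt_neqAle xz andbT.
apply: contra_neq xy => xE; apply/esym; rewrite -xE in yz.
by apply: (le_rk_eq V yz); rewrite !minimal_rk.
Qed.

(** An element covered by [z] and above [x] misses [y]; having just one atom fewer than [z], it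
    contains every other atom. *)
Lemma join_third x y (h : P) z : minimal x -> minimal y -> minimal h -> x != y -> h != y ->
  is_join x y z -> h <= z -> exists a, [/\ covers z a, x <= a & h <= a].
Proof.
move=> mx my mh xy hy J hz.
have [a za xa] := ex_covers V (join_minimal_lt mx my xy J); exists a; split=> //.
have /is_joinP[_ yz zmin] := J.
have ya : ~~ (y <= a).
  by apply/negP => /(zmin a xa)/(le_lt_trans)/(_ (covers_lt za)); rewrite ltxx.
have /eqP/cards1P[t tE] := card_atoms_covers za.
have yt : y \in atoms z :\: atoms a by rewrite !inE my yz /= andbT.
apply: contraNT hy => ha.
have : h \in atoms z :\: atoms a by rewrite !inE mh hz /= andbT.
by move: yt; rewrite tE !inE => /eqP-> /eqP->.
Qed.

(** Each of the two elements covered by [v] misses exactly one atom of [v]. These two atoms are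
    distinct, and nothing strictly below [v] contains both. *)
Lemma ex_join v : (1 < rk v)%N ->
  exists x y, [/\ minimal x, minimal y, x != y & is_join x y v].
Proof.
move=> v1; have [a [b [ab va vb cov]]] := ex_covered V v1.
have /eqP/cards1P[y yE] := card_atoms_covers va.
have /eqP/cards1P[x xE] := card_atoms_covers vb.
have : y \in atoms v :\: atoms a by rewrite yE set11.
have : x \in atoms v :\: atoms b by rewrite xE set11.
rewrite !inE => /andP[xb /andP[mx xv]] /andP[ya /andP[my yv]].
rewrite mx /= in xb; rewrite my /= in ya.
have xy : x != y.
  apply: contraNneq ya => e; subst y.
  have xv' : x < v by rewrite lt_neqAle xv andbT; apply: contraTneq v1 => <-; rewrite minimal_rk.
  have [c /cov[->//|->]] := ex_covers V xv'; by rewrite (negPf xb).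
exists x, y; split=> //.
have [z zP zv] := minimal_join mx my xv yv.
have [<-//|zv'] := eqVneq z v.
have [c vc zc] : exists2 c, covers v c & z <= c.
  by apply: (ex_covers V); rewrite lt_neqAle zv'.
case/is_joinP: zP => xz yz _; case/cov: vc => cE; subst c.
  by rewrite (le_trans yz zc) in ya.
by rewrite (le_trans xz zc) in xb.
Qed.

Lemma le_atoms v w : (v <= w) = (atoms v \subset atoms w).
Proof.
apply/idP/idP => [|/subsetP H]; first exact: atoms_mono.
have inw x : minimal x -> x <= v -> x <= w.
  by move=> mx xv; have := H x; rewrite !inE mx xv => /(_ isT).
have [v1|v1] := ltnP 1 (rk v).
  have [x [y [mx my _ /is_joinP[xv yv]]]] := ex_join v1.
  by apply; apply: inw.
have : minimal v by rewrite (minimalE V) eqn_leq v1 (rk_gt0 V).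
by move/inw; apply.
Qed.

Lemma omega_elt_inj : injective (@omega_elt P).
Proof. exact: val_inj. Qed.

Lemma omega_elt_minimal i : minimal (omega_elt i).
Proof. exact: valP i. Qed.

Lemma omega_eltK x : minimal x -> exists i, omega_elt i = x.
Proof. by move=> mx; exists (exist _ x mx). Qed.

Lemma omega_adjP i j :
  reflect (i != j /\ exists z, is_join (omega_elt i) (omega_elt j) z) (adj i j).
Proof.
by apply: (iffP andP) => -[ij] => [/existsP|H]; split=> //; apply/existsP.
Qed.

Lemma omega_labelE i j z : is_join (omega_elt i) (omega_elt j) z ->
  label i j = (rk z).-1.
Proof.
move=> J; rewrite /= /omega_label; case: pickP => [w wP|/(_ z)/negP[]//].
by rewrite (join_uniq J wP).
Qed.

Lemma omega_adj_in i j v : i != j -> omega_elt i <= v -> omega_elt j <= v ->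
  adj i j /\ ((label i j).+1 <= rk v)%N.
Proof.
move=> ij iv jv.
have [z zP zv] := minimal_join (omega_elt_minimal i) (omega_elt_minimal j) iv jv.
split; first by apply/omega_adjP; split=> //; exists z.
by rewrite (omega_labelE zP) prednK ?(rk_gt0 V) // (rk_le V).
Qed.

Definition omega_atoms v : {set omega P} := [set h | omega_elt h <= v].

Lemma card_omega_atoms v : #|omega_atoms v| = rk v.
Proof.
rewrite -card_atoms -(card_imset _ omega_elt_inj); apply: eq_card => x.
rewrite inE; apply/imsetP/andP => [[i iv ->]|[mx xv]].
  by rewrite omega_elt_minimal; rewrite inE in iv.
by have [i iE] := omega_eltK mx; exists i; rewrite // inE iE.
Qed.

(** For a conditioning vertex not below [z], [three_joins] would put [z] below a join of smaller
    rank. Conversely, by [join_third], a further atom below [z] shares with each end an element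
    covered by [z], so both labels are smaller. *)
Lemma omega_principal_clique i j z : i != j -> is_join (omega_elt i) (omega_elt j) z ->
  principal_clique i j = omega_atoms z.
Proof.
move=> ij J; have Lij := omega_labelE J; have /is_joinP[iz jz zmin] := J.
have Mi := omega_elt_minimal; have inj := inj_eq omega_elt_inj.
apply/setP => h; rewrite !inE; apply/idP/idP.
  case/orP => [/orP[]/eqP-> //|/and4P[/omega_adjP[ih [zih Jih]] /omega_adjP[jh [zjh Jjh]]]].
  rewrite (omega_labelE Jih) (omega_labelE Jjh) Lij => lih ljh.
  have lt w : ((rk w).-1 < (rk z).-1)%N -> ~ z <= w.
    move=> /[swap]/(rk_le V); rewrite ltnNge => zw /negP; apply.
    by rewrite -!subn1 leq_sub2r.
  have r1 (k : omega P) : rk (omega_elt k) = 1%N by apply: minimal_rk (Mi k).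
  have [||//|iz'|jz'] := three_joins V IC _ _ J Jjh Jih; rewrite ?r1 //.
    by case: (lt _ ljh); apply: zmin => //; case/is_joinP: Jjh.
  by case: (lt _ lih); apply: zmin => //; case/is_joinP: Jih.
move=> hz; have [hi|hi] // := eqVneq h i; have [hj|hj] // := eqVneq h j.
rewrite !orFb.
have third k l : k != l -> h != l -> h != k -> is_join (omega_elt k) (omega_elt l) z ->
    adj k h && (label k h < label i j)%N.
  move=> kl hl hk Jkl.
  have [||a [za ka ha]] := join_third (Mi k) (Mi l) (Mi h) _ _ Jkl hz; rewrite ?inj //.
  have [|-> lkh] := @omega_adj_in k h a _ ka ha; first by rewrite eq_sym.
  by rewrite Lij (rk_covers V za).
have /andP[-> ->] := third i j ij hj hi J.
have ji : j != i by rewrite eq_sym.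
have J' : is_join (omega_elt j) (omega_elt i) z by rewrite is_joinC.
by have /andP[-> ->] := third j i ji hi hj J'.
Qed.

(** ML2 counts the atoms below a join. For ML1, a cycle opened at the edge [{u, v}] is a chain of
    joins of rank [k + 1] with both ends below the join of [u] and [v], so [join_chain_bound] leaves
    a single step. *)
Lemma omega_MAT : MAT_labeling (omega P).
Proof.
move=> k k0; split=> [u v|u v]; last first.
  case/andP=> /omega_adjP[uv [z J]] /eqP lk.
  have D : [disjoint [set u; v] & cond_vertices u v].
    apply/pred0P => h /=; rewrite !inE; apply/negP => /andP[/orP[]/eqP->];
    by rewrite !adj_irr ?andbF.
  have := card_omega_atoms z; rewrite -(omega_principal_clique uv J) /principal_clique.
  rewrite cardsU disjoint_setI0 // cards0 subn0 cards2 uv.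
  by rewrite -lk (omega_labelE J) => <-.
move=> /omega_adjP[uv [J JP]] luv [p [p0 up pp lp]].
pose s := v :: rcons p u; pose x t := omega_elt (nth u s t).
have us : uniq s.
  by rewrite /s -rcons_cons rcons_uniq; exact: up.
have ps : path (label_class k) v (rcons p u) by rewrite rcons_path pp lp.
have szs : size s = (size p).+2 by rewrite /= size_rcons.
pose K t := odflt (x t) [pick z | is_join (x t) (x t.+1) z].
have step t : (t < (size p).+1)%N -> is_join (x t) (x t.+1) (K t) /\ rk (K t) = k.+1.
  move=> tp; have : label_class k (nth u s t) (nth u s t.+1).
    by move/pathP: ps => /(_ u t); rewrite size_rcons; apply.
  case/andP=> /omega_adjP[_ [z zP]] /eqP lz; rewrite /K.
  case: pickP => [w wP|/(_ z)]; last by rewrite zP.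
  split=> //=; move: lz; rewrite (omega_labelE wP) => <-.
  by rewrite prednK ?(rk_gt0 V).
have xinj (a b : nat) : (a < (size p).+2)%N -> (b < (size p).+2)%N -> a != b -> x a != x b.
  by move=> ap bp ab; rewrite (inj_eq omega_elt_inj) nth_uniq ?szs.
have mx t : minimal (x t) by apply: omega_elt_minimal.
have x0 : x 0%N = omega_elt v by [].
have xn : x (size p).+1 = omega_elt u by rewrite /x /= nth_rcons ltnn eqxx.
have : (size p).+1 = 1%N.
  apply: (@join_chain_bound _ V IC k.+1 1 _ x K J) => //.
  - split=> [t _|t /step[]|t /step[]|t tp] //; first exact: minimal_rk.
    (* If consecutive joins agreed, [join_third] would give a smaller element above [x t.+1] and
       [x t.+2], against their join. *)
    apply/eqP => e; have [J1 _] := step t (ltnW tp); have [J2 _] := step _ tp.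
    rewrite -e in J2; have /is_joinP[_ le2 _] := J2.
    rewrite is_joinC in J1.
    have b2 : (t.+2 < (size p).+2)%N by [].
    have [||a [ca l1 l2]] := join_third (mx t.+1) (mx t) (mx t.+2) _ _ J1 le2.
    + by apply: xinj (ltnW b2) (ltnW (ltnW b2)) _; rewrite gtn_eqF.
    + by apply: xinj b2 (ltnW (ltnW b2)) _; rewrite gtn_eqF.
    have /is_joinP[_ _ /(_ a l1 l2)] := J2.
    by move=> /le_lt_trans/(_ (covers_lt ca)); rewrite ltxx.
  - by move: luv; rewrite (omega_labelE JP) -ltnS prednK ?(rk_gt0 V).
  - by rewrite x0; case/is_joinP: JP.
  - by rewrite xn; case/is_joinP: JP.
by case: p p0 {up pp lp s x us ps szs K step xinj mx x0 xn}.
Qed.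

End OmegaMAT.

(** * The LR-vine Psi *)

Section Psi.
Local Open Scope order_scope.
Variable G : labeled_graph.
Implicit Types (i j h a b : G).

Lemma principal_cliqueC i j : principal_clique i j = principal_clique j i.
Proof.
rewrite /principal_clique setUC [[set j; i]]setUC [LHS]setUC; congr (_ :|: _).
by apply/setP => h; rewrite !inE andbCA (label_sym i j) [(label i h < _)%N && _]andbC.
Qed.

Lemma clique_l i j : i \in principal_clique i j.
Proof. by rewrite !inE eqxx. Qed.

Lemma clique_r i j : j \in principal_clique i j.
Proof. by rewrite !inE eqxx orbT. Qed.

Lemma adj_neq i j : adj i j -> i != j.
Proof. by apply: contraTneq => ->; rewrite adj_irr. Qed.

(** This holds for every MAT-labeling, but is a hypothesis for now: its proof by induction on the
    largest label uses the vine [psi] of a graph with fewer edges. Exchanging [i] and [j] gives the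
    removal of [i]. *)
Definition hereditary_cliques : Prop := forall i j, adj i j ->
  {in principal_clique i j :\ j &, forall a b, a != b ->
     adj a b && (label a b < label i j)%N} /\ psi_elt (principal_clique i j :\ j).

Hypothesis matG : MAT_labeling G.

Lemma card_clique i j : adj i j -> #|principal_clique i j| = (label i j).+1.
Proof.
move=> ij; have l0 : (0 < label i j)%N by rewrite label_gt0.
have [_ /(_ i j)] := matG l0; rewrite /label_class /= ij eqxx => /(_ isT) c.
have D : [disjoint [set i; j] & cond_vertices i j].
  apply/pred0P => h /=; rewrite !inE; apply/negP => /andP[/orP[]/eqP->];
  by rewrite !adj_irr ?andbF.
rewrite /principal_clique cardsU disjoint_setI0 // cards0 subn0 cards2 c.
by rewrite adj_neq // !addSn prednK.
Qed.

Hypothesis herG : hereditary_cliques.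

Lemma psi_eltP (A : {set G}) :
  reflect ((exists i, A = [set i]) \/
           (exists i j, adj i j /\ A = principal_clique i j)) (psi_elt A).
Proof.
apply: (iffP orP) => -[].
- by case/existsP => i /eqP; left; exists i.
- by case/existsP => i /existsP[j /andP[ij /eqP->]]; right; exists i, j.
- by case=> i ->; left; apply/existsP; exists i.
- by case=> i [j [ij ->]]; right; apply/existsP; exists i; apply/existsP; exists j; rewrite ij /=.
Qed.

Lemma psi_elt1 i : psi_elt [set i].
Proof. by apply/psi_eltP; left; exists i. Qed.

Lemma psi_elt_clique i j : adj i j -> psi_elt (principal_clique i j).
Proof. by move=> ij; apply/psi_eltP; right; exists i, j. Qed.

Lemma clique_adj i j a b : adj i j -> a \in principal_clique i j ->
  b \in principal_clique i j -> a != b -> adj a b.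
Proof.
move=> ij aK bK ab; have ji : adj j i by rewrite adj_sym.
have [Hj _] := herG ij; have [Hi _] := herG ji; rewrite -principal_cliqueC in Hi.
have adjP l H : {in principal_clique i j :\ l &, forall a b, a != b -> adj a b && H a b} ->
    a != l -> b != l -> adj a b.
  move=> Hl al bl; have aD : a \in principal_clique i j :\ l by rewrite in_setD1 al.
  have bD : b \in principal_clique i j :\ l by rewrite in_setD1 bl.
  by case/andP: (Hl a b aD bD ab).
have [aj|aj] := eqVneq a j; last have [bj|bj] := eqVneq b j; last exact: adjP Hj _ _.
- have [bi|bi] := eqVneq b i; first by rewrite aj bi.
  by apply: adjP Hi _ bi; rewrite aj adj_neq.
- have [ai|ai] := eqVneq a i; first by rewrite bj ai.
  by apply: adjP Hi ai _; rewrite bj adj_neq.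
Qed.

(** A pair other than [{i, j}] avoids an end [l], hence lies in the clique without [l], which is
    generated by an edge of smaller label. *)
Lemma clique_sub i j a b : adj i j -> a \in principal_clique i j ->
  b \in principal_clique i j -> a != b -> principal_clique a b \subset principal_clique i j.
Proof.
have [n] := ubnP (label i j); elim: n i j => // n IH i j ltn ij aK bK ab.
have step k l : adj k l -> principal_clique k l = principal_clique i j ->
    label k l = label i j -> a != l -> b != l ->
    principal_clique a b \subset principal_clique i j.
  move=> kl eK el al bl; have [_ /psi_eltP[[c cE]|[c [d [cd cE]]]]] := herG kl.
    have : a \in principal_clique k l :\ l by rewrite in_setD1 al eK.
    have : b \in principal_clique k l :\ l by rewrite in_setD1 bl eK.
    by rewrite cE !inE => /eqP bc /eqP ac; rewrite ac bc eqxx in ab.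
  have lt : (label c d < n)%N.
    have := cardsD1 l (principal_clique k l).
    rewrite clique_r cE !card_clique // el add1n => -[e].
    by rewrite e ltnS in ltn.
  have sub : principal_clique c d \subset principal_clique i j.
    by rewrite -cE eK; apply: subD1set.
  by apply: subset_trans sub; apply: IH; rewrite // -cE in_setD1 ?al ?bl eK.
have [aj|aj] := eqVneq a j; last have [bj|bj] := eqVneq b j; last exact: (step i j).
- have [bi|bi] := eqVneq b i; first by rewrite aj bi principal_cliqueC.
  apply: (step j i); rewrite // 1?adj_sym // 1?principal_cliqueC 1?label_sym //.
  by rewrite aj eq_sym adj_neq.
- have [ai|ai] := eqVneq a i; first by rewrite bj ai.
  apply: (step j i); rewrite // 1?adj_sym // 1?principal_cliqueC 1?label_sym //.
  by rewrite bj eq_sym adj_neq.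
Qed.

Implicit Types (A B C : psi G).

Lemma psi_le A B : (A <= B) = (psi_set A \subset psi_set B).
Proof. by rewrite -[LHS](Order.le_val A B) Order.SetSubsetOrder.leEsubset. Qed.

Lemma psi_lt A B : (A < B) = (psi_set A \proper psi_set B).
Proof.
by rewrite lt_neqAle psi_le properEneq.
Qed.

Lemma psi_rk A : rk A = #|psi_set A|.
Proof. by []. Qed.

Lemma psi_inj : injective (@psi_set G).
Proof. exact: val_inj. Qed.

Lemma psi_setK (X : {set G}) : psi_elt X -> exists A, psi_set A = X.
Proof. by move=> XP; exists (exist _ X XP). Qed.

Lemma psi_setP A : psi_elt (psi_set A).
Proof. exact: valP A. Qed.

Lemma psi_pair A a b : a \in psi_set A -> b \in psi_set A -> a != b ->
  adj a b /\ principal_clique a b \subset psi_set A.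
Proof.
have /psi_eltP[[c ->]|[c [d [cd ->]]]] := psi_setP A => aA bA ab.
  by move: aA bA ab; rewrite !inE => /eqP-> /eqP->; rewrite eqxx.
by split; [apply: clique_adj aA bA ab|apply: clique_sub aA bA ab].
Qed.

Lemma psi_big A : (1 < rk A)%N ->
  exists i j, adj i j /\ psi_set A = principal_clique i j.
Proof.
by have /psi_eltP[[c cE]|//] := psi_setP A; rewrite psi_rk cE cards1.
Qed.

(** [A] must miss an end of the edge generating [B], since by [psi_pair] both ends would force all
    of [B] into [A]. *)
Lemma psi_lt_split A B : A < B -> exists i j C,
  [/\ adj i j, psi_set B = principal_clique i j, psi_set C = psi_set B :\ j & A <= C].
Proof.
rewrite psi_lt => /properP[AB [x xB xA]].
have A1 : (0 < rk A)%N.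
  rewrite psi_rk; apply/card_gt0P.
  by have /psi_eltP[[c ->]|[c [d [cd ->]]]] := psi_setP A; exists c; rewrite ?clique_l ?set11.
have [|i [j [ij BE]]] := @psi_big B.
  apply: leq_ltn_trans A1 _; apply: proper_card; apply/properP; split=> //.
  by exists x.
have [jA|jA] := boolP (j \in psi_set A).
  have [iA|iA] := boolP (i \in psi_set A).
    have [_ /subsetP/(_ x)] := psi_pair iA jA (adj_neq ij).
    by rewrite -BE xB (negPf xA) => /(_ isT).
  have ji : adj j i by rewrite adj_sym.
  have [_ /psi_setK[C CE]] := herG ji; exists j, i, C; rewrite CE -principal_cliqueC BE.
  split=> //; rewrite psi_le CE -principal_cliqueC -BE.
  by apply/subsetD1P.
have [_ /psi_setK[C CE]] := herG ij; exists i, j, C; rewrite CE BE.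
by split=> //; rewrite psi_le CE -BE; apply/subsetD1P.
Qed.

(** If the ranks differ by more, the [C] of [psi_lt_split], one vertex smaller than [B], lies
    strictly in between. *)
Lemma psi_covers A B : covers B A = (psi_set A \proper psi_set B) && (rk B == (rk A).+1).
Proof.
rewrite /covers psi_lt; apply: andb_id2l => AB.
apply/negP/eqP => [noz|rB /existsP[C]]; last first.
  rewrite !psi_lt => /andP[/proper_card AC /proper_card CB].
  by have := leq_ltn_trans AC CB; rewrite -!psi_rk rB ltnn.
rewrite -psi_lt in AB; have [i [j [C [ij BE CE AC]]]] := psi_lt_split AB.
have CB : C < B.
  by rewrite psi_lt CE; apply: properD1; rewrite BE clique_r.
have [->|AC'] := eqVneq A C.
  by rewrite !psi_rk CE (cardsD1 j (psi_set B)) BE clique_r add1n.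
by case: noz; apply/existsP; exists C; rewrite CB lt_neqAle AC' AC.
Qed.

Lemma psi_graded : graded (psi G).
Proof.
split.
- move=> A; rewrite psi_rk; apply/card_gt0P.
  by have /psi_eltP[[c ->]|[c [d [cd ->]]]] := psi_setP A; exists c; rewrite ?clique_l ?set11.
- by move=> A B; rewrite psi_lt => /proper_card.
- by move=> A B; rewrite psi_covers => /andP[_ /eqP].
- move=> A mA; have /psi_eltP[[c cE]|[i [j [ij cE]]]] := psi_setP A.
    by rewrite psi_rk cE cards1.
  have [C CE] := psi_setK (psi_elt1 i).
  move/forallP: mA => /(_ C); rewrite psi_lt cE CE; case/negP.
  apply/properP; split; first by rewrite sub1set clique_l.
  by exists j; rewrite ?clique_r // inE eq_sym adj_neq.
Qed.

Lemma psi_minimal A : minimal A = (rk A == 1%N).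
Proof.
have [r0 rlt _ m1] := psi_graded.
apply/idP/eqP => [/m1 //|A1]; apply/forallP => B; apply/negP => /rlt.
by rewrite A1 ltnS leqNgt r0.
Qed.

Lemma covers_clique A B i j : adj i j -> psi_set B = principal_clique i j ->
  covers B A = (psi_set A == psi_set B :\ i) || (psi_set A == psi_set B :\ j).
Proof.
move=> ij BE.
have covD k : k \in psi_set B -> psi_set A = psi_set B :\ k -> covers B A.
  move=> kB AE; rewrite psi_covers !psi_rk AE properD1 //.
  by rewrite (cardsD1 k (psi_set B)) kB add1n eqxx.
apply/idP/orP => [|[]/eqP]; last 2 first.
- by apply: covD; rewrite BE clique_l.
- by apply: covD; rewrite BE clique_r.
rewrite psi_covers => /andP[/properP[AB [x xB xA]] /eqP rB].
have E k : k \in psi_set B -> k \notin psi_set A -> psi_set A == psi_set B :\ k.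
  move=> kB kA; rewrite eqEcard; apply/andP; split; first exact/subsetD1P.
  by have := cardsD1 k (psi_set B); rewrite kB add1n -!psi_rk rB => -[<-].
have [iA|iA] := boolP (i \in psi_set A); last by left; rewrite E // BE clique_l.
have [jA|jA] := boolP (j \in psi_set A); last by right; rewrite E // BE clique_r.
have [_ /subsetP/(_ x)] := psi_pair iA jA (adj_neq ij).
by rewrite -BE xB (negPf xA) => /(_ isT).
Qed.

Lemma psi_covers_set A B C : A != B -> covers C A -> covers C B ->
  psi_set C = psi_set A :|: psi_set B.
Proof.
rewrite !psi_covers => AB /andP[/proper_sub AC /eqP rC] /andP[/proper_sub BC /eqP rC'].
apply/esym/eqP; rewrite eqEcard subUset AC BC /= -psi_rk rC.
apply: proper_card; rewrite properEneq subsetUl andbT.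
apply: contra_neq AB => /esym/setUidPl BA; apply/esym/psi_inj/eqP.
have rAB : rk A = rk B by apply: succn_inj; rewrite -rC.
by rewrite eqEcard BA -!psi_rk rAB leqnn.
Qed.

Lemma psi_previne : previne (psi G).
Proof.
split; first exact: psi_graded.
- move=> B; rewrite psi_minimal => B1.
  have [|i [j [ij BE]]] := @psi_big B.
    by rewrite ltn_neqAle eq_sym B1; have [r0 _ _ _] := psi_graded; apply: r0.
  have ji : adj j i by rewrite adj_sym.
  have [_ /psi_setK[X XE]] := herG ij; have [_ /psi_setK[Y YE]] := herG ji.
  rewrite -principal_cliqueC -BE in YE; rewrite -BE in XE.
  have -> : covered B = [set Y; X].
    apply/setP => A; rewrite !inE (covers_clique _ ij BE).
    by rewrite -XE -YE !(inj_eq psi_inj).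
  rewrite cards2; have -> // : Y != X.
  apply/eqP => YX; have : i \in psi_set X by rewrite XE !inE adj_neq // BE clique_l.
  by rewrite -YX YE !inE eqxx.
- move=> A B C D AB _ CA CB DA DB; apply: psi_inj.
  by rewrite (psi_covers_set AB CA CB) (psi_covers_set AB DA DB).
Qed.

(** The two elements are [C] without one or the other end of its generating edge; both cover [C]
    without either end. *)
Lemma psi_proximity : proximity (psi G).
Proof.
move=> A B AB rAB rA [C [CA CB]].
have [|i [j [ij CE]]] := @psi_big C.
  by have := rk_covers psi_previne CA => ->; rewrite ltnS (leq_trans _ rA).
have key A' B' k l : adj k l -> psi_set C = principal_clique k l ->
    psi_set A' = psi_set C :\ l -> psi_set B' = psi_set C :\ k -> (1 < rk A')%N ->
    exists2 W, covers A' W & psi_set W = psi_set C :\: [set k; l].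
  move=> kl CE' AE BE r1; have [a [b [ab AE']]] := psi_big r1.
  have aA : a \in psi_set A' by rewrite AE' clique_l.
  have bA : b \in psi_set A' by rewrite AE' clique_r.
  (* Since [B'] misses [k], it cannot contain all of [A'], hence not both ends of the edge
     generating [A']. So [k] is one of these ends, and removing it leaves an element of [psi]. *)
  have : ~~ ((a \in psi_set B') && (b \in psi_set B')).
    apply/negP => /andP[aB bB].
    have [_ sub] := psi_pair aB bB (adj_neq ab); rewrite -AE' in sub.
    have : k \in psi_set A' by rewrite AE !inE adj_neq // CE' clique_l.
    by move/(subsetP sub); rewrite BE !inE eqxx.
  have kE : psi_set C :\: [set k; l] = psi_set A' :\ k.
    by rewrite AE setDDl setUC.
  rewrite negb_and kE => nAB.
  have kab : k = a \/ k = b.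
    case/orP: nAB; rewrite BE !inE negb_and negbK => /orP[/eqP ->|]; auto;
    [move: aA|move: bA]; rewrite AE in_setD1 => /andP[_ ->]//.
  have [x [y [xy AE2 kx]]] : exists x y, [/\ adj x y, psi_set A' = principal_clique x y & k = y].
    case: kab => ->; last by exists a, b.
    by exists b, a; rewrite adj_sym principal_cliqueC.
  have [_ /psi_setK[W WE]] := herG xy; exists W; last by rewrite WE -AE2 kx.
  by rewrite (covers_clique _ xy AE2) WE -AE2 eqxx orbT.
have ji : adj j i by rewrite adj_sym.
have CE' : psi_set C = principal_clique j i by rewrite CE principal_cliqueC.
have fin k l : adj k l -> psi_set C = principal_clique k l ->
    psi_set A = psi_set C :\ l -> psi_set B = psi_set C :\ k ->
    exists W, covers A W /\ covers B W.
  move=> kl CE2 AE BE; have rB : (1 < rk B)%N by rewrite -rAB.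
  have [W AW WE] := key A B k l kl CE2 AE BE rA.
  have lk : adj l k by rewrite adj_sym.
  rewrite principal_cliqueC in CE2; have [W' BW' WE'] := key B A l k lk CE2 BE AE rB.
  exists W; split=> //; suff -> : W = W' by [].
  by apply: psi_inj; rewrite WE WE' setUC.
move: CA CB AB; rewrite !(covers_clique _ ij CE).
case/orP=> /eqP AE /orP[]/eqP BE.
- by rewrite -(inj_eq psi_inj) AE BE eqxx.
- by move=> _; apply: (fin j i).
- by move=> _; apply: (fin i j).
- by rewrite -(inj_eq psi_inj) AE BE eqxx.
Qed.

End Psi.

(** * Cycles of siblings under proximity *)

Section CommonCover.
Local Open Scope order_scope.
Variable P : ranked_poset.
Hypotheses (preP : previne P) (prox : proximity P).
Implicit Types (A B C D M x y z : P).

Definition level_acyclic k : Prop := forall c : seq P,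
  (2 < size c)%N -> {in c, forall x, rk x = k} -> ~ ucycle sibling c.

(** An element is an edge of the graph one level down; here the edge [A] is deleted. *)
Definition sibling_not_via A : rel P :=
  [rel x y | (x != y) && [exists B, [&& B != A, covers B x & covers B y]]].

(** In a forest every edge is a bridge: a way around [A] would close up with it to a cycle. *)
Lemma bridge k A D D' : level_acyclic k -> rk D = k -> covers A D -> covers A D' ->
  connect (sibling_not_via A) D D' -> D = D'.
Proof.
move=> acyc rD AD AD' /connectP[p0 p0P]; case/shortenP: p0P => p pp up _ D'E {p0}.
apply/eqP/negPn/negP => DD'.
have sp : path sibling D p.
  apply: sub_path pp => x y /andP[xy /existsP[B /and3P[_ Bx By]]].
  by rewrite /sibling /= xy; apply/existsP; exists B; rewrite Bx.
case: (acyc (D :: p)).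
(* A way of one step would be a second element covering both [D] and [D']. *)
- case: p => [|E [|F p]] //= in pp up sp D'E *; first by rewrite D'E eqxx in DD'.
  subst E; move: pp; rewrite andbT => /andP[_ /existsP[B /and3P[/eqP BA BD BD']]].
  by case: BA; apply: (covers_uniq preP DD').
- move=> x xp; case/splitPl: xp sp => p1 p2 <-.
  rewrite cat_path => /andP[sp _]; rewrite -rD; apply/esym.
  by apply: (connect_sibling_rk preP); apply/connectP; exists p1.
- rewrite /ucycle up andbT /cycle rcons_path sp -D'E /sibling /= eq_sym DD'.
  by apply/existsP; exists A; rewrite AD' AD.
Qed.

Lemma sibling_common_below x y : sibling x y -> (1 < rk x)%N ->
  exists w, covers x w /\ covers y w.
Proof.
move=> xy rx; have rxy := sibling_rk preP xy.
case/andP: xy => xy /existsP[v /andP[vx vy]].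
by apply: prox => //; exists v.
Qed.

(** Consecutive siblings cover a common element, so the path projects to a walk one level down whose
    edges are its own terms, never [A]. *)
Lemma path_not_via A B s D D' : path sibling B s -> A \notin B :: s -> (1 < rk B)%N ->
  covers B D -> covers (last B s) D' -> connect (sibling_not_via A) D D'.
Proof.
have one C x y : A != C -> covers C x -> covers C y -> connect (sibling_not_via A) x y.
  move=> AC Cx Cy; have [->|xy] := eqVneq x y; first exact: connect0.
  by apply: connect1; rewrite /sibling_not_via /= xy; apply/existsP; exists C; rewrite eq_sym AC Cx.
elim: s B D => [|C s IH] B D /=; first by rewrite inE => _ AB _; apply: one.
move=> /andP[BC Cs]; rewrite inE negb_or => /andP[AB ACs] rB BD lD'.
have [M [BM CM]] := sibling_common_below BC rB.
apply: (@connect_trans _ _ M); first exact: one AB BD BM.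
by apply: IH Cs ACs _ CM lD'; rewrite -(sibling_rk preP BC).
Qed.

(* Otherwise the cycle would traverse an edge of the forest one level below
   exactly once. *)
Lemma cycle_common_cover k c : level_acyclic k -> (0 < k)%N -> (2 < size c)%N ->
  {in c, forall x, rk x = k.+1} -> ucycle sibling c ->
  exists M, {in c, forall x, covers x M}.
Proof.
move=> acyc k0 sz rc uc; case: c => // z c0 in sz rc uc *; set c := z :: c0 in rc uc *.
have zl : sibling (last z c) z.
  by case/andP: uc; rewrite /c /cycle rcons_path => /andP[].
have rl : rk (last z c) = k.+1 by apply: rc; rewrite /c (mem_last z c0).
have [M [lM zM]] := sibling_common_below zl (ltac:(by rewrite rl)); exists M.
(* Rotation moves the claim from the head [B] to the next term [C]: their common element [M']
   reaches [M] through the rest of the cycle without the edge [B], so [bridge] gives [M' = M]. *)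
have inv n : covers (head z (rot n c)) M /\ covers (last z (rot n c)) M.
  elim: n => [|n [hM tM]]; first by rewrite rot0.
  have [nc|nc] := ltnP n (size c); last first.
    by rewrite !rot_oversize // ltnW.
  rewrite -addn1 addnC rotD; last by rewrite add1n.
  have : ucycle sibling (rot n c) by rewrite rot_ucycle.
  have : {in rot n c, forall x, rk x = k.+1} by move=> x; rewrite mem_rot; apply: rc.
  have : (2 < size (rot n c))%N by rewrite size_rot.
  case: (rot n c) hM tM => [|B [|C s]] // BM lM' s0 rk' /andP[cBC uB].
  rewrite /= in cBC; case/andP: cBC => BC Cs.
  rewrite rot1_cons last_rcons; split=> //; rewrite -[head _ _]/C.
  have rB : rk B = k.+1 by apply: rk'; rewrite inE eqxx.
  have rC : rk C = k.+1 by apply: rk'; rewrite !inE eqxx orbT.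
  have [M' [BM' CM']] := sibling_common_below BC (ltac:(by rewrite rB)).
  have Cs' : path sibling C s by move: Cs; rewrite rcons_path => /andP[].
  have nB : B \notin C :: s by case/andP: uB.
  suff <- : M' = M by [].
  apply: (bridge acyc _ BM' BM).
    by apply: succn_inj; rewrite -rC (rk_covers preP CM').
  by apply: path_not_via Cs' nB _ CM' lM'; rewrite rC.
move=> x xc; have [+ _] := inv (index x c).
by rewrite /rot (drop_index xc).
Qed.

End CommonCover.

(** * The levels of [psi] are forests *)

Section PsiVine.
Local Open Scope order_scope.
Variable G : labeled_graph.
Hypotheses (matG : MAT_labeling G) (herG : hereditary_cliques G).
Implicit Types (A B C : psi G) (i j a b : G).

(** The element covering [A] and [B] is their union, with [#|X| + 2] vertices. The ends of its
    generating edge are the vertices missed by [A] and by [B], namely [b] and [a]. *)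
Lemma sunflower_label (X : {set G}) A B a b : sibling A B ->
  a \notin X -> b \notin X -> psi_set A = a |: X -> psi_set B = b |: X ->
  label_class #|X|.+1 a b.
Proof.
case/andP=> AB /existsP[C /andP[CA CB]] aX bX AE BE.
have ab : a != b by apply: contraNneq AB => e; apply/eqP/psi_inj; rewrite AE BE e.
have CE := psi_covers_set matG herG AB CA CB; rewrite AE BE in CE.
have [|i [j [ij CE']]] := @psi_big _ C.
  have [r0 _ _ _] := psi_graded matG herG.
  by rewrite (rk_covers (psi_previne matG herG) CA) ltnS r0.
have bC : b \in psi_set C by rewrite CE !inE eqxx !orbT.
have aC : a \in psi_set C by rewrite CE !inE eqxx.
have bA : b \notin psi_set A by rewrite AE !inE negb_or eq_sym ab.
have aB : a \notin psi_set B by rewrite BE !inE negb_or ab.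
have inP (Y : psi G) y : covers C Y -> y \in psi_set C -> y \notin psi_set Y -> y = i \/ y = j.
  rewrite (covers_clique matG herG _ ij CE') => /orP[]/eqP-> yC; rewrite !inE yC andbT negbK => /eqP; auto.
have lab : label i j = #|X|.+1.
  have := card_clique matG ij; rewrite -CE' CE => /eqP.
  have -> : (a |: X) :|: (b |: X) = a |: (b |: X) by rewrite setUACA setUid setUA.
  by rewrite !cardsU1 bX !inE negb_or ab aX add1n => /eqP[].
have [ea|ea] := inP _ _ CB aC aB; have [eb|eb] := inP _ _ CA bC bA.
- by rewrite ea eb eqxx in ab.
- by rewrite /label_class /= ea eb ij lab eqxx.
- by rewrite /label_class /= ea eb adj_sym ij label_sym lab eqxx.
- by rewrite ea eb eqxx in ab.
Qed.

Lemma label_class_acyclic k (c : seq G) : (0 < k)%N -> (2 < size c)%N ->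
  ~ ucycle (@label_class G k) c.
Proof.
case: c => [|u [|v [|w p]]] // k0 _ /andP[cuv up].
rewrite /= in cuv; case/and3P: cuv => uv vw; rewrite rcons_path => /andP[wp pu].
have [/(_ u v) H _] := matG k0; case/andP: uv => uv /eqP luv.
apply: H; rewrite ?luv //; exists (w :: p); split=> //.
by apply/andP.
Qed.

Lemma sunflower_acyclic (X : {set G}) (c : seq (psi G)) : (2 < size c)%N ->
  {in c, forall A, exists2 a, a \notin X & psi_set A = a |: X} -> ~ ucycle sibling c.
Proof.
case: c => // A0 c0 sz; set c := A0 :: c0 => H /andP[cc uc].
have [a0 _ _] := H A0 (mem_head _ _).
(* The vertex of [A] outside [X]; the default [a0] never occurs on the cycle. *)
pose pt A := odflt a0 [pick a in psi_set A :\: X].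
have ptP A : A \in c -> pt A \notin X /\ psi_set A = pt A |: X.
  move=> /H[a aX AE]; suff -> : pt A = a by [].
  have D : psi_set A :\: X = [set a].
    rewrite AE setDUl setDv setU0; apply/setDidPl; by rewrite disjoints1.
  by rewrite /pt; case: pickP => [b|/(_ a)]; rewrite D !inE ?eqxx // => /eqP.
apply: (@label_class_acyclic #|X|.+1 (map pt c)) => //; first by rewrite size_map.
apply/andP; split; last first.
  rewrite map_inj_in_uniq // => A B /ptP[_ AE] /ptP[_ BE] e.
  by apply: psi_inj; rewrite AE BE e.
have sub : {in c &, subrel sibling (relpre pt (@label_class G #|X|.+1))}.
  move=> A B Ac Bc AB; have [aX AE] := ptP _ Ac; have [bX BE] := ptP _ Bc.
  exact: sunflower_label AB aX bX AE BE.
by rewrite cycle_map; apply: (sub_in_cycle sub) cc; apply/allP.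
Qed.

(** On level 1 the core of the sunflower is empty; above it, [cycle_common_cover] supplies the core
    [M]. *)
Lemma psi_acyclic k : (0 < k)%N -> level_acyclic (psi G) k.
Proof.
case: k => // k _; elim: k => [|k IH] c sz rc uc.
  apply: (@sunflower_acyclic set0 c sz _ uc) => A /rc/eqP/cards1P[a aE].
  by exists a; rewrite ?inE // setU0.
have [M MP] := cycle_common_cover (psi_previne matG herG) (psi_proximity matG herG)
                  IH isT sz rc uc.
apply: (@sunflower_acyclic (psi_set M) c sz _ uc) => A /MP.
rewrite psi_covers // => /andP[/properP[MA [a aA aM]] /eqP rA]; exists a => //.
apply/esym/eqP; rewrite eqEcard subUset sub1set aA MA.
by rewrite cardsU1 aM add1n -!psi_rk rA leqnn.
Qed.

Lemma psi_vine : vine (psi G).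
Proof.
have preP := psi_previne matG herG.
have [gr cov un] := preP; split=> // i /andP[i0 _] c sz /andP[cc uc].
apply: (psi_acyclic i0 sz).
  move=> A Ac; have := next_cycle cc Ac.
  by rewrite (level_adjP preP) => /andP[/eqP].
rewrite /ucycle uc andbT; apply: sub_cycle cc => A B.
by rewrite (level_adjP preP) => /andP[].
Qed.

(** The atoms below [A] are the singletons of its vertices, so their number is the rank. *)
Lemma psi_LR_vine : LR_vine (psi G).
Proof.
apply: (LR_vine_intro psi_vine (psi_proximity matG herG)) => A.
rewrite psi_rk -[RHS](card_imset _ (@set1_inj G)) -(card_imset _ (@psi_inj G)).
apply: eq_card => X; apply/imsetP/imsetP => -[].
  move=> B; rewrite inE psi_minimal // psi_rk psi_le => /andP[/cards1P[a aE] BA] ->.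
  exists a => //.
  by move: BA; rewrite aE sub1set.
move=> a aA ->; have [B BE] := psi_setK (psi_elt1 a); exists B => //.
by rewrite inE psi_minimal // psi_rk psi_le BE cards1 sub1set aA.
Qed.

End PsiVine.

(** * Deleting the edges of large label *)

Section Truncation.
Variables (G : labeled_graph) (N : nat).
Implicit Types u v h : G.

Definition trunc_adj : rel G := [rel u v | adj u v && (label u v < N)%N].

Definition trunc_label u v : nat := if (label u v < N)%N then label u v else 0%N.

Fact trunc_adj_irr : irreflexive trunc_adj.
Proof. by move=> u; rewrite /trunc_adj /= adj_irr. Qed.

Fact trunc_adj_sym : symmetric trunc_adj.
Proof. by move=> u v; rewrite /trunc_adj /= adj_sym label_sym. Qed.

Fact trunc_label_sym u v : trunc_label u v = trunc_label v u.
Proof. by rewrite /trunc_label label_sym. Qed.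

Fact trunc_label_gt0 u v : (0 < trunc_label u v)%N = trunc_adj u v.
Proof.
by rewrite /trunc_label /trunc_adj /=; case: ifP => _; rewrite ?andbT ?andbF // label_gt0.
Qed.

Definition trunc : labeled_graph :=
  LabeledGraph trunc_adj_irr trunc_adj_sym trunc_label_sym trunc_label_gt0.

Lemma trunc_adjE u v : @adj trunc u v = adj u v && (label u v < N)%N.
Proof. by []. Qed.

Lemma trunc_labelE u v : (label u v < N)%N -> @label trunc u v = label u v.
Proof. by rewrite /= /trunc_label => ->. Qed.

Lemma trunc_cond_vertices u v : (label u v < N)%N ->
  @cond_vertices trunc u v = cond_vertices u v.
Proof.
move=> uvN; apply/setP => h; rewrite !inE !trunc_adjE (trunc_labelE uvN).
apply/and4P/and4P => [[/andP[-> uh] /andP[-> vh]]|[uh vh luh lvh]].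
  by rewrite !trunc_labelE.
have uhN := ltn_trans luh uvN; have vhN := ltn_trans lvh uvN.
by rewrite !trunc_labelE // uh vh uhN vhN.
Qed.

Lemma trunc_clique u v : (label u v < N)%N ->
  @principal_clique trunc u v = principal_clique u v.
Proof. by move=> uvN; rewrite /principal_clique trunc_cond_vertices. Qed.

Lemma trunc_label_class k : (0 < k)%N -> subrel (@label_class trunc k) (@label_class G k).
Proof.
move=> k0 u v; rewrite /label_class /= => /andP[/andP[-> uvN]].
by rewrite /trunc_label uvN.
Qed.

Lemma trunc_MAT : MAT_labeling G -> MAT_labeling trunc.
Proof.
move=> matG k k0; have [H1 H2] := matG k k0; split=> u v.
  rewrite trunc_adjE => /andP[uv uvN]; rewrite trunc_labelE // => luv.
  case=> p [p0 up pp lp]; apply: (H1 u v uv luv); exists p; split=> //.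
    by apply: sub_path pp; apply: trunc_label_class.
  exact: trunc_label_class lp.
move=> uv; have := trunc_label_class k0 uv => /H2 <-.
rewrite trunc_cond_vertices //; by case/andP: uv => /andP[].
Qed.

Lemma trunc_psi_elt (A : {set G}) : @psi_elt trunc A -> psi_elt A.
Proof.
move=> /psi_eltP[[i ->]|[i [j [ij ->]]]]; first exact: psi_elt1.
move: ij; rewrite trunc_adjE => /andP[ij ijN].
by rewrite trunc_clique //; apply: psi_elt_clique.
Qed.

End Truncation.

(* The induction removes the edges of maximal label; such an edge is then put
   back by [common_neighbours_top] in the poset of the truncated graph. *)
Lemma bounded_hereditary n (G : labeled_graph) : MAT_labeling G ->
  (forall u v : G, label u v <= n)%N -> hereditary_cliques G.
Proof.
elim: n G => [|n IH] G matG maxG i j ij.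
  by move: ij; rewrite -label_gt0 ltnNge maxG.
set H := trunc G n.+1; have matH : MAT_labeling H by apply: trunc_MAT.
have herH : hereditary_cliques H.
  apply: IH => // u v; rewrite /= /trunc_label; case: ifP => //.
(* An edge of label at most [n] has the same clique in [H], where the induction hypothesis
   applies. *)
have := maxG i j; rewrite leq_eqVlt => /predU1P[lij|lij]; last first.
  have ij' : @adj H i j by rewrite trunc_adjE ij.
  have [h1 h2] := herH i j ij'; rewrite trunc_clique // in h1 h2.
  split; last exact: trunc_psi_elt h2.
  move=> a b aK bK ab; have := h1 a b aK bK ab; rewrite trunc_adjE (trunc_labelE lij).
  by case/andP=> /andP[-> abN]; rewrite trunc_labelE.
have cardc : #|cond_vertices i j| = n.
  have [_ /(_ i j)] := matG n.+1 isT; rewrite /label_class /= ij lij eqxx.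
  by apply.
(* Inside an element of [psi H] all pairs are edges of [H], hence of label below [n.+1]. *)
suff [A [AE iA cA]] : exists A : psi H, [/\ psi_set A = principal_clique i j :\ j,
    i \in psi_set A & rk A = n.+1].
  rewrite -AE; split; last by apply: trunc_psi_elt; apply: psi_setP.
  move=> a b aA bA ab; have [+ _] := psi_pair matH herH aA bA ab.
  by rewrite trunc_adjE lij.
have ijn : i != j := adj_neq ij.
have KE : principal_clique i j :\ j = i |: cond_vertices i j.
  apply/setP => h; rewrite !inE; have [->|hj] := eqVneq h j.
    by rewrite adj_irr !andbF eq_sym (negPf ijn).
  by rewrite orbF.
have [{IH maxG}n0|n0] := posnP n.
  have [A AE] := psi_setK (@psi_elt1 H i); exists A.
  rewrite psi_rk AE KE cards1 set11 n0; split=> //.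
  by move/eqP: cardc; rewrite n0 cards_eq0 => /eqP->; rewrite setU0.
have V := psi_vine matH herH.
have IC : ideals_connected (psi H).
  by apply: proximity_connected => //; apply: psi_proximity.
have [u uE] := psi_setK (@psi_elt1 H i); have [v vE] := psi_setK (@psi_elt1 H j).
have maxr (A : psi H) : (rk A <= n.+1)%N.
  have [|A1] := ltnP 1 (rk A); last exact: leq_trans A1 _.
  case/psi_big => a [b [ab AE]]; rewrite psi_rk AE card_clique //.
  by move: ab; rewrite trunc_adjE => /andP[_ lab]; rewrite trunc_labelE.
have nb (A : psi H) : i \in psi_set A -> j \in psi_set A -> False.
  move=> iA jA; have [+ _] := psi_pair matH herH iA jA ijn.
  by rewrite trunc_adjE lij ltnn andbF.
have r1 (w : psi H) (a : H) : psi_set w = [set a] -> rk w = 1%N.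
  by move=> wE; rewrite psi_rk wE cards1.
have bnd (w w' : psi H) (a b : H) : psi_set w = [set a] -> psi_set w' = [set b] ->
    @adj H a b -> bounded w w'.
  move=> wE wE' ab; have [C CE] := psi_setK (psi_elt_clique ab).
  by apply/boundedP; exists C; rewrite psi_le CE ?wE ?wE' sub1set ?clique_l ?clique_r.
have condP h : h \in cond_vertices i j -> @adj H i h /\ @adj H j h.
  by rewrite inE lij !trunc_adjE => /and4P[-> -> -> ->].
(* The singletons have rank 1 and the ranks are at most [n.+1], so [n] common neighbours are
   required: the conditioning vertices. *)
have [||||A [B [D [rA AD BD]]]] := @common_neighbours_top _ V IC n.+1 n.-1 u v maxr.
- by rewrite (r1 _ _ uE) prednK.
- by rewrite (r1 _ _ uE) (r1 _ _ vE).
- apply/boundedP => -[w]; rewrite !psi_le uE vE !sub1set; exact: nb.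
- pose sing (h : G) : psi H := exist _ [set h] (@psi_elt1 H h).
  have singE h : psi_set (sing h) = [set h] by [].
  have sing_inj : injective sing by move=> a b /(congr1 (@psi_set H)) /set1_inj.
  rewrite prednK // -{1}cardc -(card_imset _ sing_inj); apply: subset_leq_card.
  apply/subsetP => _ /imsetP[h /condP[ih jh] ->].
  rewrite inE (r1 _ _ uE) (r1 _ _ (singE h)) eqxx (bnd _ _ _ _ uE (singE h) ih).
  by rewrite (bnd _ _ _ _ (singE h) vE) // adj_sym.
rewrite !psi_le uE vE !sub1set => iA jB.
have := AD; have := BD; rewrite !psi_covers //.
move=> /andP[/proper_sub DB _] /andP[/proper_sub DA /eqP rD].
have iD : i \notin psi_set D by apply/negP => /(subsetP DB) /nb; apply.
have jD : j \notin psi_set D by apply/negP => /(subsetP DA) /(nb _ iA).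
(* [D] lies in [A], which contains [i], and in [B], which contains [j]. So its [n] vertices are
   adjacent in [H] to both ends. *)
have DE : psi_set D = cond_vertices i j.
  apply/eqP; rewrite eqEcard cardc; apply/andP; split; last first.
    by rewrite -psi_rk -ltnS -rD rA.
  apply/subsetP => d dD.
  have di : i != d by apply: contraNneq iD => ->.
  have dj : j != d by apply: contraNneq jD => ->.
  have [+ _] := psi_pair matH herH iA (subsetP DA _ dD) di.
  have [+ _] := psi_pair matH herH jB (subsetP DB _ dD) dj.
  by rewrite !trunc_adjE inE lij => /andP[-> ->] /andP[-> ->].
exists A; split=> //; rewrite KE -DE; apply/esym/eqP.
rewrite eqEcard subUset sub1set iA DA cardsU1 iD add1n -psi_rk.
by rewrite [#|psi_set D|](esym (psi_rk D)) -rD leqnn.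
Qed.

Lemma MAT_hereditary (G : labeled_graph) : MAT_labeling G -> hereditary_cliques G.
Proof.
move=> matG; apply: (@bounded_hereditary (\max_(p : G * G) label p.1 p.2)) => // u v.
exact: (@leq_bigmax _ (fun p : G * G => label p.1 p.2) (u, v)).
Qed.

(** * Functoriality and natural isomorphisms *)

Section PsiFunctor.
Local Open Scope order_scope.

Definition psi_LR (G : MAT_graph) : LR_vine (psi G) :=
  psi_LR_vine (MAT_graph_labeling G) (MAT_hereditary (MAT_graph_labeling G)).

Definition Psi_obj (G : MAT_graph) : LR_vine_poset := LRVinePoset (psi_LR G).

Variables (G G' : MAT_graph) (s : MG_hom G G').
Let matG := MAT_graph_labeling G.
Let herG := MAT_hereditary matG.
Let matG' := MAT_graph_labeling G'.
Let herG' := MAT_hereditary matG'.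

Lemma MG_homP u v : adj u v ->
  adj (MG_fun s u) (MG_fun s v) /\ label (MG_fun s u) (MG_fun s v) = label u v.
Proof.
move=> uv; have := valP s; move/forallP/(_ u)/forallP/(_ v)/implyP/(_ uv).
by case/andP=> -> /eqP.
Qed.

Lemma MG_hom_inj (A : psi G) : {in psi_set A &, injective (MG_fun s)}.
Proof.
move=> a b aA bA e; apply/eqP/negPn/negP => ab.
have [/MG_homP[+ _] _] := psi_pair matG herG aA bA ab.
by rewrite e adj_irr.
Qed.

(** Preserved labels send conditioning vertices to conditioning vertices. Equality follows by
    counting, since the map is injective on a clique and both cliques have one vertex more than the
    common label. *)
Lemma imset_clique i j : adj i j ->
  MG_fun s @: principal_clique i j = principal_clique (MG_fun s i) (MG_fun s j).
Proof.
move=> ij; have [sij lij] := MG_homP ij; have [K KE] := psi_setK (psi_elt_clique ij).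
have inj := @MG_hom_inj K; rewrite KE in inj.
apply/eqP; rewrite eqEcard (card_in_imset inj) !card_clique // lij leqnn andbT.
apply/subsetP => _ /imsetP[h hK ->]; move: hK; rewrite !inE.
case/orP=> [/orP[]/eqP->|/and4P[ih jh lih ljh]]; rewrite ?eqxx ?orbT //.
have [-> e1] := MG_homP ih; have [-> e2] := MG_homP jh.
by rewrite e1 e2 lij lih ljh orbT.
Qed.

Lemma psi_elt_imset (A : psi G) : psi_elt (MG_fun s @: psi_set A).
Proof.
have /psi_eltP[[i ->]|[i [j [ij ->]]]] := psi_setP A.
  by rewrite imset_set1 psi_elt1.
by rewrite imset_clique //; apply: psi_elt_clique; case: (MG_homP ij).
Qed.

Definition psi_map (A : psi G) : psi G' := exist (@psi_elt G') _ (psi_elt_imset A).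

Lemma psi_map_set A : psi_set (psi_map A) = MG_fun s @: psi_set A.
Proof. by []. Qed.

Lemma psi_map_join A B C : is_join A B C -> is_join (psi_map A) (psi_map B) (psi_map C).
Proof.
move=> /is_joinP[AC BC Cmin]; apply/is_joinP; rewrite !psi_le !psi_map_set.
split; rewrite ?imsetS -?psi_le // => W; rewrite !psi_le !psi_map_set => AW BW.
have /psi_eltP[[c CE]|[i [j [ij CE]]]] := psi_setP C.
  suff <- : A = C by [].
  have [r0 _ _ _] := psi_graded matG herG.
  move: AC; rewrite psi_le CE subset1 => /orP[/eqP AE|A0].
    by apply: psi_inj; rewrite AE CE.
  by have := r0 A; rewrite psi_rk (eqP A0) cards0.
(* An end [l] in neither [A] nor [B] would make [C] without [l] a smaller upper bound. So [W]
   contains the images of both ends, and with them the clique they generate. *)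
have top k l : adj k l -> psi_set C = principal_clique k l -> MG_fun s l \in psi_set W.
  move=> kl CE'; have [_ /psi_setK[Y YE]] := herG kl.
  have [lA|lA] := boolP (l \in psi_set A); first by apply: (subsetP AW); apply: imset_f.
  have [lB|lB] := boolP (l \in psi_set B); first by apply: (subsetP BW); apply: imset_f.
  have : C <= Y.
    by apply: Cmin; rewrite psi_le YE -CE'; apply/subsetD1P; rewrite -psi_le.
  rewrite psi_le YE => /subsetP/(_ l).
  by rewrite CE' clique_r !inE eqxx => /(_ isT).
have jW := top i j ij CE.
have iW : MG_fun s i \in psi_set W.
  by apply: (top j i); rewrite // 1?adj_sym // principal_cliqueC.
rewrite CE imset_clique //; have [sij _] := MG_homP ij.
by have [_ ] := psi_pair matG' herG' iW jW (adj_neq sij).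
Qed.

Lemma psi_map_hom : rank_join_preserving [ffun A => psi_map A].
Proof.
apply/and3P; split.
- apply/forallP => A; apply/forallP => B; apply/implyP; rewrite !ffunE !psi_le !psi_map_set.
  exact: imsetS.
- apply/forallP => A; rewrite ffunE !psi_rk psi_map_set card_in_imset //.
  exact: MG_hom_inj.
- apply/forallP => A; apply/forallP => B; apply/forallP => C; apply/implyP.
  by rewrite !ffunE; apply: psi_map_join.
Qed.

Definition Psi_mor : LRV_hom (Psi_obj G) (Psi_obj G') := Sub _ psi_map_hom.

Lemma Psi_morE (A : psi G) : psi_set (LRV_fun Psi_mor A) = MG_fun s @: psi_set A.
Proof. by rewrite /LRV_fun /= ffunE. Qed.

End PsiFunctor.

Lemma LRV_hom_eq (P P' : ranked_poset) (f g : LRV_hom P P') :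
  (forall x, LRV_fun f x = LRV_fun g x) -> f = g.
Proof. by move=> e; apply/val_inj/ffunP. Qed.

Lemma MG_hom_eq (G G' : labeled_graph) (s t : MG_hom G G') :
  (forall x, MG_fun s x = MG_fun t x) -> s = t.
Proof. by move=> e; apply/val_inj/ffunP. Qed.

Lemma LRV_compE (P P' P'' : ranked_poset) (g : LRV_hom P' P'') (f : LRV_hom P P') x :
  LRV_fun (LRV_comp g f) x = LRV_fun g (LRV_fun f x).
Proof. by rewrite /LRV_fun /= ffunE. Qed.

Lemma MG_compE (G G' G'' : labeled_graph) (t : MG_hom G' G'') (s : MG_hom G G') x :
  MG_fun (MG_comp t s) x = MG_fun t (MG_fun s x).
Proof. by rewrite /MG_fun /= ffunE. Qed.

Lemma LRV_idE (P : ranked_poset) x : LRV_fun (LRV_id P) x = x.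
Proof. by rewrite /LRV_fun /= ffunE. Qed.

Lemma MG_idE (G : labeled_graph) x : MG_fun (MG_id G) x = x.
Proof. by rewrite /MG_fun /= ffunE. Qed.

Fact Psi_id (G : MAT_graph) : Psi_mor (MG_id G) = LRV_id (psi G).
Proof.
apply: LRV_hom_eq => A; apply: psi_inj; rewrite Psi_morE LRV_idE.
by rewrite -[RHS]imset_id; apply: eq_imset => a; rewrite MG_idE.
Qed.

Fact Psi_comp (G G' G'' : MAT_graph) (t : MG_hom G' G'') (s : MG_hom G G') :
  Psi_mor (MG_comp t s) = LRV_comp (Psi_mor t) (Psi_mor s).
Proof.
apply: LRV_hom_eq => A; apply: psi_inj; rewrite LRV_compE !Psi_morE.
by rewrite -imset_comp; apply: eq_imset => a; rewrite MG_compE.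
Qed.

Definition Psi_functor : @functor MG LRV Psi_obj :=
  @Functor MG LRV Psi_obj (fun _ _ s => Psi_mor s) Psi_id (fun _ _ _ t s => Psi_comp t s).

(** * The functor Omega *)

Definition Omega_obj (P : LR_vine_poset) : MAT_graph := MATGraph (omega_MAT P).

Section OmegaFunctor.
Local Open Scope order_scope.
Variables (P P' : LR_vine_poset) (f : LRV_hom P P').
Let V := LR_vineP P.
Let V' := LR_vineP P'.

Lemma LRV_hom_le x y : x <= y -> LRV_fun f x <= LRV_fun f y.
Proof.
by have /and3P[/forallP/(_ x)/forallP/(_ y)/implyP] := valP f.
Qed.

Lemma LRV_hom_rk x : rk (LRV_fun f x) = rk x.
Proof. by have /and3P[_ /forallP/(_ x)/eqP] := valP f. Qed.

Lemma LRV_hom_join x y z : is_join x y z ->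
  is_join (LRV_fun f x) (LRV_fun f y) (LRV_fun f z).
Proof.
by have /and3P[_ _ /forallP/(_ x)/forallP/(_ y)/forallP/(_ z)/implyP] := valP f.
Qed.

Lemma LRV_hom_minimal (i : omega P) : minimal (LRV_fun f (omega_elt i)).
Proof. by rewrite (minimalE V') LRV_hom_rk -(minimalE V) omega_elt_minimal. Qed.

Definition omega_map (i : omega P) : omega P' := exist (@minimal P') _ (LRV_hom_minimal i).

Lemma omega_map_hom : label_preserving [ffun i : omega P => omega_map i].
Proof.
apply/forallP => i; apply/forallP => j; apply/implyP => /omega_adjP[ij [z zP]].
rewrite !ffunE; have fzP := LRV_hom_join zP.
apply/andP; split; last by rewrite (omega_labelE zP) (@omega_labelE P' (omega_map i) (omega_map j) _ fzP) LRV_hom_rk.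
apply/omega_adjP; split; last by exists (LRV_fun f z).
(* If the images of [i] and [j] coincided, their join would be that image, of rank smaller than that
   of the image of [z]. *)
apply/eqP => /(congr1 (@omega_elt P')) /= e.
have iz : (rk (omega_elt i) < rk z)%N.
  apply: (rk_lt V); by apply: (join_minimal_lt _ _ _ zP); rewrite ?omega_elt_minimal.
have /is_joinP[_ _ /(_ (LRV_fun f (omega_elt i)))] := fzP.
rewrite lexx -[LRV_fun f (omega_elt j)]e lexx => /(_ isT isT) /(rk_le V').
by rewrite !LRV_hom_rk leqNgt iz.
Qed.

Definition Omega_mor : MG_hom (omega P) (omega P') := Sub _ omega_map_hom.

Lemma Omega_morE (i : omega P) :
  omega_elt (MG_fun Omega_mor i) = LRV_fun f (omega_elt i).
Proof. by rewrite /MG_fun /= ffunE. Qed.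

End OmegaFunctor.

Fact Omega_id (P : LR_vine_poset) : Omega_mor (LRV_id P) = MG_id (omega P).
Proof.
by apply: MG_hom_eq => i; apply: omega_elt_inj; rewrite Omega_morE LRV_idE MG_idE.
Qed.

Fact Omega_comp (P P' P'' : LR_vine_poset) (g : LRV_hom P' P'') (f : LRV_hom P P') :
  Omega_mor (LRV_comp g f) = MG_comp (Omega_mor g) (Omega_mor f).
Proof.
apply: MG_hom_eq => i; apply: omega_elt_inj.
by rewrite Omega_morE LRV_compE MG_compE !Omega_morE.
Qed.

Definition Omega_functor : @functor LRV MG Omega_obj :=
  @Functor LRV MG Omega_obj (fun _ _ f => Omega_mor f) Omega_id (fun _ _ _ g f => Omega_comp g f).

Section PosetIsomorphism.
Local Open Scope order_scope.
Variables (P P' : ranked_poset) (f : P -> P') (g : P' -> P).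
Hypotheses (gK : cancel g f) (f_le : forall x y, (f x <= f y) = (x <= y)).
Hypothesis f_rk : forall x, rk (f x) = rk x.

Lemma iso_hom : rank_join_preserving [ffun x => f x].
Proof.
apply/and3P; split; apply/forallP => x.
- by apply/forallP => y; rewrite !ffunE f_le implybb.
- by rewrite ffunE f_rk.
apply/forallP => y; apply/forallP => z; apply/implyP => /is_joinP[xz yz zmin].
rewrite !ffunE; apply/is_joinP; rewrite !f_le; split=> // w; rewrite -(gK w) !f_le.
exact: zmin.
Qed.

Definition iso_mor : LRV_hom P P' := Sub _ iso_hom.

Lemma iso_morE x : LRV_fun iso_mor x = f x.
Proof. by rewrite /LRV_fun /= ffunE. Qed.

End PosetIsomorphism.

(** * The isomorphism between an LR-vine and its image under Psi Omega *)

Section PsiOmega.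
Local Open Scope order_scope.
Variable P : LR_vine_poset.
Let V := LR_vineP P.
Implicit Types (v w : P).

Lemma psi_elt_omega_atoms v : psi_elt (omega_atoms v).
Proof.
have [v1|v1] := ltnP 1 (rk v).
  have [x [y [mx my xy J]]] := ex_join v1.
  have [i iE] := omega_eltK mx; have [j jE] := omega_eltK my; subst x y.
  have ij : i != j by apply: contraNneq xy => ->.
  rewrite -(omega_principal_clique ij J); apply: psi_elt_clique.
  by apply/omega_adjP; split=> //; exists v.
have /cards1P[i ->] : #|omega_atoms v| == 1%N.
  by rewrite card_omega_atoms eqn_leq v1 (rk_gt0 V).
exact: psi_elt1.
Qed.

Definition to_psi v : psi (omega P) := exist (@psi_elt (omega P)) _ (psi_elt_omega_atoms v).

Lemma to_psi_le v w : (to_psi v <= to_psi w) = (v <= w).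
Proof.
rewrite psi_le le_atoms -[psi_set (to_psi v)]/(omega_atoms v).
rewrite -[psi_set (to_psi w)]/(omega_atoms w); apply/subsetP/subsetP => H.
  move=> x; rewrite !inE => /andP[mx]; have [i <-] := omega_eltK mx.
  by have := H i; rewrite !inE omega_elt_minimal.
by move=> i; have := H (omega_elt i); rewrite !inE !omega_elt_minimal.
Qed.

Lemma to_psi_rk v : rk (to_psi v) = rk v.
Proof. exact: card_omega_atoms. Qed.

Lemma to_psi_surj (A : psi (omega P)) : exists v, to_psi v == A.
Proof.
have /psi_eltP[[i AE]|[i [j [ij AE]]]] := psi_setP A.
  exists (omega_elt i); apply/eqP/psi_inj/esym/eqP; rewrite eqEcard AE sub1set inE lexx.
  by rewrite card_omega_atoms cards1 minimal_rk ?omega_elt_minimal.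
have /omega_adjP[nij [z J]] := ij; exists z; apply/eqP/psi_inj.
by rewrite AE (omega_principal_clique nij J).
Qed.

Definition of_psi (A : psi (omega P)) : P := xchoose (to_psi_surj A).

Lemma of_psiK : cancel of_psi to_psi.
Proof. by move=> A; apply/eqP/(xchooseP (to_psi_surj A)). Qed.

Lemma to_psiK : cancel to_psi of_psi.
Proof. by move=> v; apply/le_anti; rewrite -!to_psi_le of_psiK lexx. Qed.

Lemma of_psi_le A B : (of_psi A <= of_psi B) = (A <= B).
Proof. by rewrite -to_psi_le !of_psiK. Qed.

Lemma of_psi_rk A : rk (of_psi A) = rk A.
Proof. by rewrite -to_psi_rk of_psiK. Qed.

Definition to_psi_mor : LRV_hom P (psi (omega P)) := iso_mor of_psiK to_psi_le to_psi_rk.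
Definition of_psi_mor : LRV_hom (psi (omega P)) P := iso_mor to_psiK of_psi_le of_psi_rk.

End PsiOmega.

(** Atoms of [v] go to atoms of its image; equality follows because both sets have [rk v]
    elements. *)
Lemma to_psi_natural (P P' : LR_vine_poset) (f : LRV_hom P P') v :
  LRV_fun (Psi_mor (Omega_mor f : MG_hom (Omega_obj P) (Omega_obj P'))) (to_psi v) =
  to_psi (LRV_fun f v).
Proof.
apply: psi_inj; rewrite Psi_morE; apply/eqP; rewrite eqEcard; apply/andP; split.
  apply/subsetP => _ /imsetP[i iv ->]; rewrite inE Omega_morE; apply: LRV_hom_le.
  by rewrite inE in iv.
rewrite card_in_imset; last exact: (@MG_hom_inj (Omega_obj P) (Omega_obj P')).
by rewrite -[X in (X <= _)%N]psi_rk -psi_rk !to_psi_rk LRV_hom_rk.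
Qed.

Lemma PsiOmega_id : naturally_isomorphic (functor_comp Psi_functor Omega_functor)
  (functor_id LRV).
Proof.
exists (fun P => of_psi_mor P), (fun P => to_psi_mor P).
split=> [P P' f|P|P]; apply: LRV_hom_eq => x.
- apply: etrans (LRV_compE _ _ _) _; apply/esym; apply: etrans (LRV_compE _ _ _) _.
  (* The components go from the composite to the identity, so naturality is transported from
     [to_psi], where it is already known. *)
  rewrite !iso_morE; apply: (can_inj (@to_psiK P')).
  by rewrite of_psiK -to_psi_natural of_psiK.
- by apply: etrans (LRV_compE _ _ _) _; rewrite LRV_idE !iso_morE of_psiK.
- by apply: etrans (LRV_compE _ _ _) _; rewrite LRV_idE !iso_morE to_psiK.
Qed.

(** * The isomorphism between an MAT-labeled graph and its image under Omega Psi *)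

Section OmegaPsi.
Local Open Scope order_scope.
Variable G : MAT_graph.
Let matG := MAT_graph_labeling G.
Let herG := MAT_hereditary matG.
Implicit Types (i j : G).

Definition psi1 i : psi G := exist (@psi_elt G) _ (psi_elt1 i).

Lemma psi1_minimal i : minimal (psi1 i).
Proof. by rewrite psi_minimal // psi_rk cards1. Qed.

Definition to_omega i : omega (Psi_obj G) := exist (@minimal (psi G)) _ (psi1_minimal i).

Lemma to_omega_inj : injective to_omega.
Proof. by move=> i j /(congr1 (fun x => @psi_set G (@omega_elt (Psi_obj G) x))) /set1_inj. Qed.

(** By [psi_pair], an element containing [i] and [j] contains the clique they generate. This is why
    Omega recovers the label from the rank. *)
Lemma clique_join i j (K : psi G) : adj i j -> psi_set K = principal_clique i j ->
  is_join (psi1 i) (psi1 j) K.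
Proof.
move=> ij KE; apply/is_joinP; rewrite !psi_le KE !sub1set clique_l clique_r; split=> // W.
rewrite !psi_le !sub1set KE => iW jW.
by have [_ ] := psi_pair matG herG iW jW (adj_neq ij).
Qed.

Lemma to_omega_adj i j : adj (to_omega i) (to_omega j) = adj i j.
Proof.
apply/omega_adjP/idP => [[nij [z /is_joinP[+ + _]]]|ij].
  rewrite !psi_le !sub1set => iz jz; have ij : i != j by apply: contraNneq nij => ->.
  by have [] := psi_pair matG herG iz jz ij.
split; first by rewrite (inj_eq to_omega_inj) adj_neq.
by have [K KE] := psi_setK (psi_elt_clique ij); exists K; apply: clique_join.
Qed.

Lemma to_omega_label i j : adj i j -> label (to_omega i) (to_omega j) = label i j.
Proof.
move=> ij; have [K KE] := psi_setK (psi_elt_clique ij).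
have -> := @omega_labelE (Psi_obj G) (to_omega i) (to_omega j) K (clique_join ij KE).
by rewrite [rk _]psi_rk KE card_clique.
Qed.

Lemma to_omega_surj (x : omega (Psi_obj G)) : exists i, to_omega i == x.
Proof.
have := omega_elt_minimal x; rewrite psi_minimal // psi_rk => /cards1P[i iE].
by exists i; apply/eqP/omega_elt_inj/psi_inj.
Qed.

Definition of_omega x : G := xchoose (to_omega_surj x).

Lemma of_omegaK : cancel of_omega to_omega.
Proof. by move=> x; apply/eqP/(xchooseP (to_omega_surj x)). Qed.

Lemma to_omegaK : cancel to_omega of_omega.
Proof. by move=> i; apply: to_omega_inj; rewrite of_omegaK. Qed.

Lemma to_omega_hom : label_preserving [ffun i => to_omega i].
Proof.
apply/forallP => i; apply/forallP => j; apply/implyP => ij.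
by rewrite !ffunE to_omega_adj ij to_omega_label //=.
Qed.

Lemma of_omega_hom : label_preserving [ffun x => of_omega x].
Proof.
apply/forallP => x; apply/forallP => y; apply/implyP; rewrite !ffunE.
rewrite -{1 4}(of_omegaK x) -{1 4}(of_omegaK y) to_omega_adj => xy.
by rewrite xy to_omega_label //=.
Qed.

Definition to_omega_mor : MG_hom G (omega (Psi_obj G)) := Sub _ to_omega_hom.
Definition of_omega_mor : MG_hom (omega (Psi_obj G)) G := Sub _ of_omega_hom.

Lemma to_omega_morE i : MG_fun to_omega_mor i = to_omega i.
Proof. by rewrite /MG_fun /= ffunE. Qed.

Lemma of_omega_morE x : MG_fun of_omega_mor x = of_omega x.
Proof. by rewrite /MG_fun /= ffunE. Qed.

End OmegaPsi.

Lemma to_omega_natural (G G' : MAT_graph) (s : MG_hom G G') i :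
  MG_fun (Omega_mor (Psi_mor s)) (to_omega i) = to_omega (MG_fun s i).
Proof.
by apply: omega_elt_inj; apply: psi_inj; rewrite Omega_morE Psi_morE imset_set1.
Qed.

Lemma OmegaPsi_id : naturally_isomorphic (functor_comp Omega_functor Psi_functor)
  (functor_id MG).
Proof.
exists (fun G => of_omega_mor G), (fun G => to_omega_mor G).
split=> [G G' s|G|G]; apply: MG_hom_eq => x.
- apply: etrans (MG_compE _ _ _) _; apply/esym; apply: etrans (MG_compE _ _ _) _.
  rewrite !of_omega_morE; apply: (@to_omega_inj G').
  by rewrite of_omegaK -to_omega_natural of_omegaK.
- by apply: etrans (MG_compE _ _ _) _; rewrite MG_idE to_omega_morE of_omega_morE of_omegaK.
- by apply: etrans (MG_compE _ _ _) _; rewrite MG_idE to_omega_morE of_omega_morE to_omegaK.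
Qed.

Theorem theorem6p10 :
  exists (psiP : forall G : MAT_graph, LR_vine (psi G))
         (omegaP : forall P : LR_vine_poset, MAT_labeling (omega P))
         (Psi : @functor MG LRV (fun G : MAT_graph => LRVinePoset (psiP G)))
         (Omega : @functor LRV MG (fun P : LR_vine_poset => MATGraph (omegaP P))),
    (forall (G G' : MAT_graph) (s : MG_hom G G') (v : psi G),
       psi_set (LRV_fun (@fmap MG LRV _ Psi G G' s) v) =
         [set MG_fun s a | a in psi_set v]) /\
    (forall (P P' : LR_vine_poset) (f : LRV_hom P P') (i : omega P),
       omega_elt (MG_fun (@fmap LRV MG _ Omega P P' f) i) =
         LRV_fun f (omega_elt i)) /\
    naturally_isomorphic (functor_comp Psi Omega) (functor_id LRV) /\
    naturally_isomorphic (functor_comp Omega Psi) (functor_id MG) /\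
    equivalent_categories MG LRV.
Proof.
exists psi_LR, omega_MAT, Psi_functor, Omega_functor; split=> [G G' s v|].
  exact: Psi_morE.
split=> [P P' f i|]; first exact: Omega_morE.
split; first exact: PsiOmega_id.
split; first exact: OmegaPsi_id.
exists Psi_obj, Psi_functor, Omega_obj, Omega_functor.
by split; [apply: OmegaPsi_id | apply: PsiOmega_id].
Qed.
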